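(* Let $\mathcal{F}$ be a semi-metric space with semi-metric $d$, let $\mathcal{H}$ be a separable Hilbert space with norm $\|\cdot\|$, and let $(X_1,Y_1),\ldots,(X_n,Y_n)$ be a strictly stationary sequence of $\mathcal{F}\times\mathcal{H}$-valued random elements with $E\|Y_1\|<\infty$. Let $r(x)=E(Y\mid X=x)$ and $\epsilon_i=Y_i-r(X_i)$. Fix $x\in\mathcal{F}$ and let $\hat r(x)=\sum_{i=1}^n W_{ni}Y_i$, where $(W_{n1},\ldots,W_{nn})$ is a probability vector of weights, possibly depending on all of $X_1,\ldots,X_n$. Rank the observations by increasing $d(X_i,x)$ (ties broken by index), obtaining $(R_1,\ldots,R_n)$ with $X_{R_i}$ the $i$-th nearest neighbour of $x$, and set $v_{ni}=W_{nR_i}$. All probabilities and expectations are conditional on $\{X_i\}$ (so the weights are treated as fixed). Assume: (A1) $\|r(z)\|\le B$ for all $z\in\mathcal{F}$ and $\|r(z)-r(z')\|\le M_0\, d(z,z')^\alpha$ for all $z,z'$, for some constants $B,M_0,\alpha>0$. (A2) $v_{n1}\ge v_{n2}\ge\cdots\ge v_{nn}$; there is an integer $k=k_n$ with $k/n\to0$ and $k/\log n\to\infty$ such that $\sum_{i=k+1}^n v_{ni}=O(b_n)$ and $(\sum_{i=1}^n v_{ni}^2)^{1/2}=O(c_{n2})$ with $b_n\to0$, $c_{n2}\to0$; and $H\to0$, where $H=\inf\{h\in\mathbb{R}:\sum_{i=1}^n I\{d(X_i,x)\le h\}\ge k\}$ is the distance from $x$ to its $k$-th nearest neighbour. (A3)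 $\psi$ is a convex increasing function on $[0,\infty)$ with $\psi(0)=0$, and for some constant $C_0>0$, some concave increasing function $\phi$ with $\phi(0)=0,\phi(1)=1$, and some $r\ge2$, we have $t^r\le\phi(\psi(C_0t))$ for all $t\ge0$. Moreover $M:=\|\epsilon_i\|_\psi<\infty$ and the stationary sequence $(\epsilon_1,\epsilon_2,\ldots)$ is $\psi$-$m$-approximable with decay rate $\{\gamma_k\}$. Suppose there exist sequences $a_n\to0$, $L_n\to0$, $x_n\to0$ and integers $1\le m_n\le n$ (written $a,L,x,m$) such that the four sequences $\exp\{-Ca^2/(aL+m^2c_{n2}^2+x)\}$ (for some constant $C$ big enough), $1/\psi\big(\sqrt{x/2}/(\gamma_1c_{n2})\big)$, $(m/a)/\psi^{1-1/r}\big(L/(2Mmv_{n1})\big)$, and $1/\psi\big(a/(2nv_{n1}\gamma_m)\big)$ are all summable over $n$. Then $\|\hat r(x)-r(x)\|=O\big(b_n+H^\alpha+a_n+(\gamma_1v_{n1})^{1/2}\big)$ almost surely.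
   Context: Orlicz norm: for $\psi$ convex increasing on $[0,\infty)$ with $\psi(0)=0$ and a random variable $Z$ (or random element of a normed space, using $\|Z\|$), $\|Z\|_\psi=\inf\{c>0:E[\psi(|Z|/c)]\le1\}$. A sequence $\{Z_i\}$ with finite $\psi$-Orlicz norm is $\psi$-$m$-approximable if $Z_i=h(\alpha_i,\alpha_{i-1},\ldots)$ for i.i.d. random elements $\alpha_k$ and a measurable $h$, and, with $Z_i^{(m)}=h(\alpha_i,\ldots,\alpha_{i-m+1},\alpha'_{i-m},\alpha'_{i-m-1},\ldots)$ where the $\alpha'_k$ are independent copies of $\alpha_0$, $\sum_{m=1}^\infty\|Z_m-Z_m^{(m)}\|_\psi<\infty$; it has decay rate $\gamma_k$ if $\sum_{m=k}^\infty\|Z_m-Z_m^{(m)}\|_\psi=O(\gamma_k)$. $\psi^{1-1/r}$ denotes $\psi(\cdot)^{1-1/r}$. *)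

(* Defs.v *)
From HB Require Import structures.
From mathcomp Require Import all_boot all_order all_algebra.
From mathcomp Require Import all_classical all_reals all_analysis.
Set Implicit Arguments. Unset Strict Implicit. Unset Printing Implicit Defensive.
Import Order.TTheory GRing.Theory Num.Theory.
Import numFieldNormedType.Exports.
Local Open Scope classical_set_scope.
Local Open Scope ring_scope.

Definition is_inner_product (R : realType) (V : normedModType R)
    (ip : V -> V -> R) : Prop :=
  (forall u v, ip u v = ip v u) /\
  (forall (a : R) (u v w : V), ip (a *: u + v) w = a * ip u w + ip v w) /\
  (forall v, `|v| = Num.sqrt (ip v v)).

Definition separable_space (T : topologicalType) : Prop :=
  exists D : set T, countable D /\ closure D = setT.

(* Semi-metric (in the sense of functional data analysis: a pseudometric,
   d z z' = 0 need not imply z = z'). *)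
Definition semi_metric (R : realType) (F : Type) (d : F -> F -> R) : Prop :=
  (forall z z', 0 <= d z z') /\ (forall z, d z z = 0) /\
  (forall z z', d z z' = d z' z) /\
  (forall z z' z'', d z z'' <= d z z' + d z' z'').

(* ---------- Orlicz norm of a real random variable (used with f = ||Z||) ---------- *)
Definition orlicz_norm d (T : measurableType d) (R : realType)
    (P : set T -> \bar R) (psi : R -> R) (f : T -> R) : \bar R :=
  ereal_inf [set c%:E | c in
    [set c : R | 0 < c /\ (\int[P]_w (psi (f w / c))%:E <= 1)%E]].

Definition iid_family d (T : measurableType d) (R : realType) dS
    (S : measurableType dS) (P : probability T R) (alpha : int -> T -> S) : Prop :=
  (forall k, measurable_fun setT (alpha k)) /\
  (forall (s : seq int) (A : int -> set S), uniq s ->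
     (forall k, measurable (A k)) ->
     P (\big[setI/setT]_(k <- s) (alpha k @^-1` A k)) =
     (\prod_(k <- s) P (alpha (0%R : int) @^-1` A k))%E).

Definition cylinders dS (S : measurableType dS) : set (set (nat -> S)) :=
  [set B | exists (j : nat) (A : set S), measurable A /\ B = (fun u => u j) @^-1` A].

(* measurability of h : S^N -> H, for the product sigma-algebra on S^N and the
   Borel sigma-algebra of the separable Hilbert space H (which is generated by
   the maps v |-> ip v e) *)
Definition meas_seq_to_hilbert dS (S : measurableType dS) (R : realType)
    (V : normedModType R) (ip : V -> V -> R) (h : (nat -> S) -> V) : Prop :=
  forall (e : V) (B : set R), measurable B ->
    <<s @cylinders _ S >> ((fun u => ip (h u) e) @^-1` B).

(* ---------- psi-m-approximability with decay rate gamma ----------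
   Z_i = h(alpha_i, alpha_{i-1}, ...); the coupled variable
   Z_m^{(m)} = h(alpha_m, ..., alpha_1, alpha'_0, alpha'_{-1}, ...) is realised on
   the product space (T * T, P x P), alpha'_k being alpha_k on the second factor. *)
Definition psi_m_approx d (T : measurableType d) (R : realType)
    (V : normedModType R) (ip : V -> V -> R) (P : probability T R)
    (psi : R -> R) (Z : nat -> T -> V) (gamma : nat -> R) : Prop :=
  exists (dS : measure_display) (S : measurableType dS)
         (alpha : int -> T -> S) (h : (nat -> S) -> V),
    iid_family P alpha /\ meas_seq_to_hilbert ip h /\
    (forall i : nat, Z i = fun w => h (fun j : nat => alpha (i%:Z - j%:Z) w)) /\
    (forall i : nat, (orlicz_norm P psi (fun w => (`|Z i w|)%R) < +oo)%E) /\
    let D (m : nat) := orlicz_norm (P \x P)%E psi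
      (fun p : T * T => `| h (fun j : nat => alpha (m%:Z - j%:Z) p.1)
          - h (fun j : nat => if (j < m)%N then alpha (m%:Z - j%:Z) p.1
                              else alpha (m%:Z - j%:Z) p.2) |) in
    (\sum_(1 <= m <oo) D m < +oo)%E /\
    exists C : R, forall k : nat, (1 <= k)%N ->
      (\sum_(k <= m <oo) D m <= (C * gamma k)%:E)%E.

Definition nn_order (R : realType) (F : Type) (d : F -> F -> R) (X : nat -> F)
    (x : F) (n : nat) : seq nat :=
  sort (fun i j => (d (X i) x < d (X j) x) ||
                   ((d (X i) x == d (X j) x) && (i <= j)%N)) (iota 0 n).

(* v_{n,i+1} = W_{n, R_{i+1}} (0-based i) *)
Definition nn_weight (R : realType) (F : Type) (d : F -> F -> R) (X : nat -> F)
    (x : F) (W : nat -> nat -> R) (n i : nat) : R :=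
  W n (nth 0%N (nn_order d X x n) i).

Definition knn_radius (R : realType) (F : Type) (d : F -> F -> R) (X : nat -> F)
    (x : F) (k n : nat) : R :=
  inf [set h : R | (k <= count (fun i => (d (X i) x <= h)%R) (iota 0 n))%N].

(* Main.v *)
Require Import Defs.
From HB Require Import structures.
From mathcomp Require Import all_boot all_order all_algebra.
From mathcomp Require Import all_classical all_reals all_analysis.
From mathcomp Require Import measurable_realfun zify ring lra.
Set Implicit Arguments. Unset Strict Implicit. Unset Printing Implicit Defensive.
Import Order.TTheory GRing.Theory Num.Theory.
Import numFieldNormedType.Exports.
Local Open Scope classical_set_scope.
Local Open Scope ring_scope.

(** The bias is deterministic: the [k] nearest neighbours lie within the radius [H],
    where [r] is Hoelder, and the remaining weights add up to [O(b_n)].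

    For the noise, let [mu] be the law on [S^N] of the past [(alpha_0, alpha_-1, ...)],
    so that [eps_i] is [h] evaluated at a shifted past.  By Fubini one can fix, for
    each [n], a deterministic sequence [u0] such that replacing the coordinates beyond
    the [m]-th by [u0] changes [h] only by [O(gamma_m)] in Orlicz norm; the resulting
    variables are [m]-dependent.  The replacement error is controlled by Markov's
    inequality for [psi] (fourth series), the part exceeding the truncation level
    [L / (m v_n1)] by Markov's inequality and [t^r <= 1 + psi (C0 t)] (third series).
    The truncated variables split into [m] residue classes of independent blocks, to
    which a Hilbert space Bernstein inequality in the style of Pinelis applies; Jensen's
    inequality for the exponential recombines the classes (first series).  The small
    means created by the truncation enter the exponential bound as a drift, so no
    vector-valued expectation is needed.  Borel-Cantelli concludes. *)

(** The coupled copy in the hypothesis has a random far past on a second factor. A separate copy for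
    every index would need a larger space, and one shared random tail would leave the blocks only
    conditionally independent. A frozen tail turns [h] into a function of [m] coordinates, whose
    shifts by multiples of [m] are independent on the original space. The price is that centering
    and moments survive only approximately: the two Orlicz bounds are kept up to a factor 3 by a
    mean value argument on their sum, and the lost centering is measured by scalar products against
    the centered [h].

    The cosh of the norm is used because its increment inequality in a Hilbert space has
    dimension-free constants and a first-order term that is a scalar product with the current sum.

    An Orlicz norm is an infimum, so moment bounds are read off at strictly larger scales. As
    division by zero gives zero, the third and fourth series say nothing when [M] or [gamma (m n)]
    vanishes. Both difficulties are met by choosing the scales anew for each [n], at the cost of a
    summable slack. *)

Definition coshR (R : realType) (x : R) : R := (expR x + expR (- x)) / 2.
Definition sinhR (R : realType) (x : R) : R := (expR x - expR (- x)) / 2.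

(** * Hyperbolic functions and elementary exponential inequalities *)

Section hyperbolic.
Context {R : realType}.
Implicit Types x y z p q t : R.

Lemma exprn_convex p q t j : 0 <= p -> 0 <= q -> 0 <= t -> t <= 1 ->
  (t * p + (1 - t) * q) ^+ j <= t * p ^+ j + (1 - t) * q ^+ j.
Proof.
move=> p0 q0 t0 t1; elim: j => [|j IH]; first by rewrite !expr0; lra.
have pq0 : 0 <= t * p + (1 - t) * q by nra.
rewrite exprS (le_trans (ler_wpM2l pq0 IH))// !exprS.
(* The defect of the induction step is [t * (1 - t)] times this product, and powers are ordered like
   their bases. *)
suff : 0 <= (p - q) * (p ^+ j - q ^+ j) by move=> h; have := mulr_ge0 (mulr_ge0 t0 (_ : 0 <= 1 - t)) h; nra.
have [pq|/ltW qp] := leP p q.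
  by rewrite mulr_le0// subr_le0// lerXn2r// nnegrE.
by rewrite mulr_ge0// subr_ge0// lerXn2r// nnegrE.
Qed.

Lemma cvg_series_coshR x :
  (fun n => (series (exp_coeff x) n + series (exp_coeff (- x)) n) / 2) @ \oo
    --> coshR x.
Proof. by apply: cvgM; [apply: cvgD; apply: is_cvg_series_exp_coeff|exact: cvg_cst]. Qed.

(** As a function of the square of its argument, cosh is a power series with nonnegative
    coefficients, hence convex. The form with squares needs no sign of [p], [q], [z]; a difference
    of two norms is used for [q]. *)
Lemma coshR_sqr_convex p q z t : 0 <= t -> t <= 1 ->
  z ^+ 2 = t * p ^+ 2 + (1 - t) * q ^+ 2 ->
  coshR z <= t * coshR p + (1 - t) * coshR q.
Proof.
move=> t0 t1 zpq.
apply: (@ler_cvg_to _ _ _ _ _ _ _ _ (@cvg_series_coshR z)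
  (cvgD (cvgM (cvg_cst t) (@cvg_series_coshR p))
        (cvgM (cvg_cst (1 - t)) (@cvg_series_coshR q)))).
apply: nearW => n /=.
have coshE : forall y, (series (exp_coeff y) n + series (exp_coeff (- y)) n) / 2 =
    \sum_(0 <= i < n) (if odd i then 0 else (y ^+ 2) ^+ i./2 / i`!%:R).
  move=> y; rewrite /series/= -big_split/= mulr_suml; apply: eq_bigr => i _.
  rewrite /exp_coeff/= exprNn -signr_odd; case: ifPn => oi.
    by rewrite expr1 mulN1r mulNr subrr mul0r.
  rewrite expr0 mul1r -exprM mulnC muln2 halfK (negbTE oi) subn0; field.
  by rewrite pnatr_eq0 -lt0n fact_gt0.
rewrite coshE [leRHS](_ : _ = t * \sum_(0 <= i < n) (if odd i then 0 else (p ^+ 2) ^+ i./2 / i`!%:R) + (1 - t) * \sum_(0 <= i < n) (if odd i then 0 else (q ^+ 2) ^+ i./2 / i`!%:R)); last first.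
  by rewrite -!coshE.
rewrite !mulr_sumr -big_split/= ler_sum// => i _.
case: ifPn => oi; first by rewrite !mulr0 addr0.
rewrite !mulrA -mulrDl ler_pM2r ?invr_gt0 ?ltr0n ?fact_gt0// zpq.
by apply: exprn_convex => //; exact: sqr_ge0.
Qed.

Lemma sinhR_ge y : 0 <= y -> y <= sinhR y.
Proof.
move=> y0.
have cv : (fun n => (series (exp_coeff y) n - series (exp_coeff (- y)) n) / 2) @ \oo
    --> sinhR y.
  by apply: cvgM; [apply: cvgB; apply: is_cvg_series_exp_coeff|exact: cvg_cst].
apply: (ler_cvg_to (cvg_cst y) cv).
near=> n.
rewrite /series/= -sumrB mulr_suml.
have n2 : (2 <= n)%N by near: n; exact: nbhs_infty_ge.
rewrite (@big_cat_nat _ _ _ 2%N)//= !big_nat_recl//= big_geq// addr0 /exp_coeff/=.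
rewrite !expr0 !expr1 subrr mul0r add0r.
have -> : (y / (1`!)%:R - (- y) / (1`!)%:R) / 2 = y by rewrite factS fact0 muln1; lra.
rewrite lerDl; apply: sumr_ge0 => i _; apply: mulr_ge0 => //.
rewrite exprNn -signr_odd; case: (odd i).
  by rewrite expr1 mulN1r mulNr opprK addr_ge0// divr_ge0// exprn_ge0.
by rewrite expr0 mul1r subrr.
Unshelve. all: by end_near. Qed.

Lemma coshR_ge1 x : 1 <= coshR x.
Proof.
rewrite /coshR ler_pdivlMr// mul1r.
have := expR_ge1Dx x; have := expR_ge1Dx (- x); lra.
Qed.

Lemma sinhR_le_coshR x : sinhR x <= coshR x.
Proof. rewrite /sinhR /coshR; have := expR_ge0 (- x); lra. Qed.

Lemma expR_le_coshR x : expR x <= 2 * coshR x.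
Proof. rewrite /coshR; have := expR_ge0 (- x); lra. Qed.

(** By the addition formulas the two gaps are exactly [expR (- x) * (sinhR y - y)] and
    [expR x * (sinhR y - y)]. Both bounds share one remainder, so that interpolating between them is
    affine in the cosine of an angle. *)
Lemma coshR_abs_le x y : 0 <= x -> 0 <= y ->
  coshR (x + y) <= coshR x + sinhR x * y + coshR x * (expR y - 1 - y) /\
  coshR (x - y) <= coshR x - sinhR x * y + coshR x * (expR y - 1 - y).
Proof.
move=> x0 y0.
have := sinhR_ge y0; rewrite /sinhR.
have := sinhR_ge x0; rewrite /sinhR /coshR.
rewrite !opprD opprK !expRD.
have ex := expR_ge0 x; have ey := expR_ge0 y.
have ex' := expR_ge0 (- x); have ey' := expR_ge0 (- y).
move: (expR x) (expR y) (expR (- x)) (expR (- y)) ex ey ex' ey' => X Y X' Y' *.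
by split; nra.
Qed.

(** From [1 - y <= expR (- y)] the left side is at most [y ^+ 2 / (1 - y)]; this is the origin of
    the threshold 1/2 in the step conditions below. *)
Lemma expR_quad y : 0 <= y -> y <= 1 / 2 -> expR y - 1 - y <= 2 * y ^+ 2.
Proof.
move=> y0 y1.
have := expR_ge1Dx (- y); have := expRxMexpNx_1 y.
have := expR_gt0 y.
move: (expR y) (expR (- y)) => X Y; nra.
Qed.

Lemma expR_sum_le n (s : nat -> R) : (0 < n)%N ->
  expR (\sum_(i < n) s i) <= n%:R^-1 * \sum_(i < n) expR (n%:R * s i).
Proof.
move=> n0; set m := \sum_(i < n) s i.
have nR : (0 : R) < n%:R by rewrite ltr0n.
(* Jensen's inequality through the tangent of the exponential at [m], the mean of the numbers
   [n%:R * s i]. *)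
have tang z : expR m * (1 + (z - m)) <= expR z.
  by rewrite -[X in _ <= expR X](subrK m) expRD mulrC ler_pM2r ?expR_gt0// expR_ge1Dx.
rewrite ler_pdivlMl//.
apply: (@le_trans _ _ (\sum_(i < n) expR m * (1 + (n%:R * s i - m)))); last first.
  by apply: ler_sum.
rewrite -mulr_sumr big_split/= sumrB !sumr_const !card_ord -mulr_sumr -/m.
by rewrite -(mulr_natr m) mulrC ler_wpM2l ?expR_ge0// mulrC; lra.
Qed.

End hyperbolic.

(** * Inner product calculus and the one-step inequality *)

Section hilbert.
Context {R : realType} {V : normedModType R} {ip : V -> V -> R}.
Hypothesis ipP : is_inner_product ip.
Implicit Types u v w e : V.

Lemma ipC u v : ip u v = ip v u. Proof. by case: ipP. Qed.

Lemma ipDZ (c : R) u v w : ip (c *: u + v) w = c * ip u w + ip v w.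
Proof. by case: ipP => _ []. Qed.

Lemma ip0l v : ip 0 v = 0.
Proof. have := ipDZ 1 0 0 v; rewrite scaler0 addr0 mul1r; lra. Qed.

Lemma ipDl u v w : ip (u + v) w = ip u w + ip v w.
Proof. by rewrite -[u in LHS]scale1r ipDZ mul1r. Qed.

Lemma ipZl (c : R) u w : ip (c *: u) w = c * ip u w.
Proof. by rewrite -[X in ip X]addr0 ipDZ ip0l addr0. Qed.

Lemma ipDr u v w : ip w (u + v) = ip w u + ip w v.
Proof. by rewrite !(ipC w) ipDl. Qed.

Lemma ipZr (c : R) u w : ip w (c *: u) = c * ip w u.
Proof. by rewrite !(ipC w) ipZl. Qed.

Lemma ipNl u w : ip (- u) w = - ip u w.
Proof. by rewrite -scaleN1r ipZl mulN1r. Qed.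

Lemma ipBl u v w : ip (u - v) w = ip u w - ip v w.
Proof. by rewrite ipDl ipNl. Qed.

Lemma ip_suml (I : Type) (s : seq I) (P : pred I) (F : I -> V) w :
  ip (\sum_(i <- s | P i) F i) w = \sum_(i <- s | P i) ip (F i) w.
Proof.
apply: (big_morph (fun z => ip z w)); [by move=> ? ?; rewrite ipDl|exact: ip0l].
Qed.

(** Positivity is not among the clauses of [is_inner_product]. A negative [ip v v] would have square
    root 0, so [v] would have norm 0 and be 0. *)
Lemma ip_ge0 v : 0 <= ip v v.
Proof.
have [_ [_ hn]] := ipP.
rewrite leNgt; apply/negP => v0.
have : `|v| = 0 by rewrite hn; apply/eqP; rewrite sqrtr_eq0 ltW.
by move/normr0_eq0 => v00; move: v0; rewrite v00 ip0l ltxx.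
Qed.

Lemma ip_norm v : ip v v = `|v| ^+ 2.
Proof. by have [_ [_ ->]] := ipP; rewrite sqr_sqrtr// ip_ge0. Qed.

Lemma sqr_normD u v : `|u + v| ^+ 2 = `|u| ^+ 2 + 2 * ip u v + `|v| ^+ 2.
Proof. by rewrite -!ip_norm ipDl !ipDr (ipC v u); ring. Qed.

Lemma ip_CS u v : `|ip u v| <= `|u| * `|v|.
Proof.
have [->|v0] := eqVneq v 0; first by rewrite ipC ip0l !normr0 mulr0.
have nv : 0 < `|v| by rewrite normr_gt0.
have h : 0 <= `| `|v| ^+ 2 *: u + (- ip u v) *: v| ^+ 2 by exact: sqr_ge0.
rewrite sqr_normD !normrZ !exprMn ipZl ipZr in h.
rewrite -(@ler_pXn2r _ 2)// ?nnegrE ?mulr_ge0//.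
have hh : 0 <= `|v| ^+ 2 * ((`|u| * `|v|) ^+ 2 - `|ip u v| ^+ 2).
  move: h; rewrite !real_normK ?num_real//; set z := ip u v; set a := `|u|; set b := `|v|.
  move=> h; apply: le_trans h _.
  by rewrite le_eqVlt; apply/orP; left; apply/eqP; ring.
by move: hh; rewrite pmulr_rge0 ?exprn_gt0// subr_ge0.
Qed.

(* One step of Pinelis' exponential inequality in Hilbert space: as a function of
   the cosine of the angle, the left side is convex and the right side affine, so
   only collinear vectors matter. *)
Lemma coshR_normD_le s d :
  coshR `|s + d| <= coshR `|s| + (sinhR `|s| / `|s|) * ip s d
     + coshR `|s| * (expR `|d| - 1 - `|d|).
Proof.
have [s0|s0] := eqVneq s 0.
  rewrite s0 add0r ip0l mulr0 addr0 normr0.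
  have [+ _] := @coshR_abs_le R 0 `|d| (lexx _) (normr_ge0 _).
  by rewrite add0r /sinhR oppr0 subrr !mul0r addr0.
have [d0|d0] := eqVneq d 0.
  by rewrite d0 addr0 ipC ip0l mulr0 addr0 normr0 expR0 !subr0 subrr mulr0 addr0.
have ns : 0 < `|s| by rewrite normr_gt0.
have nd : 0 < `|d| by rewrite normr_gt0.
have := ip_CS s d; rewrite ler_norml => /andP[c1 c2].
set x := `|s| in ns c1 c2 *; set y := `|d| in nd c1 c2 *.
set z := ip s d in c1 c2 *.
have xy : 0 < x * y by rewrite mulr_gt0.
pose c := z / (x * y).
have zE : z = c * (x * y) by rewrite /c divfK// gt_eqF.
have cm : -1 <= c by rewrite /c ler_pdivlMr// mulN1r.
have cp : c <= 1 by rewrite /c ler_pdivrMr// mul1r.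
have t0 : 0 <= (1 + c) / 2 by lra.
have t1 : (1 + c) / 2 <= 1 by lra.
have e : `|s + d| ^+ 2 = (1 + c) / 2 * (x + y) ^+ 2 + (1 - (1 + c) / 2) * (x - y) ^+ 2.
  by rewrite sqr_normD -/x -/y -/z zE; field.
have [h1 h2] := coshR_abs_le (ltW ns) (ltW nd).
apply: (le_trans (coshR_sqr_convex t0 t1 e)).
have -> : sinhR x / x * z = sinhR x * (c * y) by rewrite zE; field; rewrite gt_eqF.
have t1' : 0 <= 1 - (1 + c) / 2 by lra.
have := ler_wpM2l t0 h1; have := ler_wpM2l t1' h2.
move: (coshR (x + y)) (coshR (x - y)) (coshR x) (sinhR x) (expR y).
move=> A B C D E h3 h4.
apply: (le_trans (lerD h4 h3)); set l := (X in X <= _); set r := (X in _ <= X).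
have -> : l = r by rewrite /l /r; field.
exact: lexx.
Qed.

End hilbert.

(** [V] carries no sigma-algebra here; scalar products are the form in which measurability of [h] is
    given. *)
Definition weakly_measurable (R : realType) (V : normedModType R) (ip : V -> V -> R)
    d (T : measurableType d) (f : T -> V) : Prop :=
  forall e, measurable_fun setT (fun u => ip (f u) e).

(** * Weak measurability and measurability of the norm *)

Section weak_measurability.
Context {R : realType} {V : normedModType R} {ip : V -> V -> R}.
Hypothesis ipP : is_inner_product ip.
Context {d : measure_display} {T : measurableType d}.
Local Notation wmeas := (weakly_measurable ip).

Lemma wmeasD (f g : T -> V) : wmeas f -> wmeas g -> wmeas (fun u => f u + g u).
Proof.
move=> mf mg e; under eq_fun do rewrite (ipDl ipP).
exact: measurable_funD.
Qed.

Lemma wmeasZ (r : T -> R) (f : T -> V) : measurable_fun setT r -> wmeas f ->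
  wmeas (fun u => r u *: f u).
Proof.
move=> mr mf e; under eq_fun do rewrite (ipZl ipP).
exact: measurable_funM.
Qed.

Lemma wmeasB (f g : T -> V) : wmeas f -> wmeas g -> wmeas (fun u => f u - g u).
Proof.
move=> mf mg e; under eq_fun do rewrite (ipBl ipP).
exact: measurable_funB.
Qed.

Lemma wmeas_sum (I : Type) (s : seq I) (f : I -> T -> V) :
  (forall i, wmeas (f i)) -> wmeas (fun u => \sum_(i <- s) f i u).
Proof.
move=> mf e; under eq_fun do rewrite (ip_suml ipP).
by apply: measurable_sum => i; exact: mf.
Qed.

Lemma wmeas_comp d' (T' : measurableType d') (f : T' -> V) (g : T -> T') :
  weakly_measurable ip f -> measurable_fun setT g -> wmeas (fun u => f (g u)).
Proof. by move=> mf mg e; apply: (measurableT_comp (mf e) mg). Qed.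

(** Since [2 * ip v e - |e|^2 = |v|^2 - |v - e|^2], the squared norm is the supremum of these
    expressions over a dense set. With a countable one, the norm of a weakly measurable function
    becomes measurable. *)
Lemma sqr_norm_gtP (D : set V) (v : V) (c : R) : closure D = setT ->
  c < `|v| ^+ 2 <-> exists2 e, D e & c < 2 * ip v e - `|e| ^+ 2.
Proof.
move=> cD.
have key e : 2 * ip v e - `|e| ^+ 2 = `|v| ^+ 2 - `|v - e| ^+ 2.
  rewrite -[X in v + X]scaleN1r (sqr_normD ipP) (ipZr ipP) normrZ.
  have -> : `|-1 : R| = 1 by rewrite normrN1.
  by ring.
split => [vc|[e _]]; last first.
  by rewrite key => /lt_le_trans; apply; rewrite gerBl sqr_ge0.
have p0 : 0 < `|v| ^+ 2 - c by rewrite subr_gt0.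
have r0 : 0 < Num.sqrt (`|v| ^+ 2 - c) by rewrite sqrtr_gt0.
have : closure D v by rewrite cD.
move=> /(_ _ (nbhsx_ballx v _ r0))[e [De]].
rewrite -ball_normE /ball_/= => ve; exists e => //; rewrite key.
rewrite ltrBrDr -ltrBrDl -(sqr_sqrtr (ltW p0)).
by rewrite ltr_pXn2r// nnegrE// ltW.
Qed.

Lemma wmeas_norm (f : T -> V) : separable_space V -> wmeas f ->
  measurable_fun setT (fun u => `|f u|).
Proof.
move=> [D [cD dD]] mf.
have -> : (fun u => `|f u|) = (fun u => Num.sqrt (`|f u| ^+ 2)).
  by apply/funext => u; rewrite sqrtr_sqr normr_id.
apply: (measurableT_comp (nondecreasing_measurable measurableT (@ler_wsqrtr R))).
apply: (measurability (@RGenOInfty.G R)); first exact: RGenOInfty.measurableE.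
move=> _ [_ [c ->] <-]; rewrite setTI.
rewrite [X in measurable X](_ : _ = \bigcup_(e in D) ((fun u => 2 * ip (f u) e - `|e| ^+ 2) @^-1` `]c, +oo[)).
  rewrite bigcup_set_type; apply: countable_bigcupT_measurable.
    by apply/countable_injP; have [g gi] := countable_injP _ cD; exists (g \o val) => x y _ _ /= gxy; apply/val_inj/gi => //; apply/mem_set; exact: set_valP.
  move=> e; rewrite -[X in measurable X]setTI.
  have mm : measurable_fun setT (fun u => 2 * ip (f u) (val e) - `|val e| ^+ 2).
    by apply: measurable_funB => //; apply: measurable_funM => //; exact: mf.
  by apply: mm => //; exact: measurable_itv.
apply/seteqP; split => u /=; rewrite in_itv/= andbT.
  by move/(sqr_norm_gtP _ _ dD) => [e De h]; exists e => //=; rewrite in_itv/= andbT.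
move=> [e De]; rewrite /= in_itv/= andbT => h; apply/(sqr_norm_gtP _ _ dD).
by exists e.
Qed.

Definition truncate (t : R) (f : T -> V) (u : T) : V := if `|f u| <= t then f u else 0.

Lemma wmeas_truncate (t : R) (f : T -> V) : separable_space V -> wmeas f ->
  wmeas (truncate t f).
Proof.
move=> sV mf e; rewrite /truncate.
under eq_fun do rewrite (fun_if (ip^~ e)) (ip0l ipP).
apply: measurable_fun_ifT => //; apply: measurable_fun_ler => //.
exact: wmeas_norm.
Qed.

End weak_measurability.

(** * Markov's inequality and one integrated exponential step *)

Section probability_bounds.
Context {R : realType} {d : measure_display} {T : measurableType d}.
Variable mu : probability T R.
Implicit Types f g : T -> R.

Lemma markov_real f (c : R) : measurable_fun setT f -> (forall u, 0 <= f u) -> 0 < c ->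
  (mu [set u | (c <= f u)%R] <= (c^-1)%:E * \int[mu]_u (f u)%:E)%E.
Proof.
move=> mf f0 c0.
set S := [set u | _].
have -> : mu S = ((c^-1)%:E * (c%:E * mu S))%E.
  by rewrite muleA -EFinM mulVf ?gt_eqF// mul1e.
apply: lee_wpmul2l; first by rewrite lee_fin invr_ge0 ltW.
have := @le_integral_comp_abse _ _ _ mu setT measurableT (EFin \o f) c id.
rewrite setTI/= => /(_ _ _ _ _ c0).
under eq_integral do rewrite (ger0_norm (f0 _)).
have -> : [set x | (c%:E <= `|f x|%:E)%E] = S.
  by apply/seteqP; split => u /=; rewrite lee_fin ger0_norm.
by apply => //; exact/measurable_EFinP.
Qed.

Lemma bounded_integrable f (b : R) : measurable_fun setT f -> (forall u, `|f u| <= b) ->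
  mu.-integrable setT (EFin \o f).
Proof.
move=> mf fb; apply: measurable_bounded_integrable => //.
  by apply: (@le_lt_trans _ _ 1%E); [exact: probability_le1|exact: ltry].
by exists b; split; [exact: num_real|move=> x bx u _; exact: le_trans (fb u) (ltW bx)].
Qed.

Lemma integral_cst_prob (c : R) : (\int[mu]_u c%:E = c%:E)%E.
Proof.
have mu1 : mu setT = 1%E by exact: probability_setT.
by rewrite integral_cst// [X in (_ * X)%E]mu1 mule1.
Qed.

Lemma measurable_coshR : measurable_fun setT (@coshR R).
Proof.
apply: measurable_funM => //; apply: measurable_funD; first exact: measurable_expR.
exact: (measurableT_comp (@measurable_expR R) (@oppr_measurable R _)).
Qed.

Lemma EFin_Rintegral f : mu.-integrable setT (EFin \o f) ->
  (\int[mu]_u (f u)%:E)%E = (\int[mu]_u f u)%:E.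
Proof. by move=> fi; rewrite /Rintegral fineK//; exact: integrable_fin_num. Qed.

(* No centering is required: the drift of [f] only enters through [beta]. *)
Lemma integral_coshR_normD {V : normedModType R} {ip : V -> V -> R} (f : T -> V) (s : V)
    (w t beta sig2 : R) :
  is_inner_product ip -> separable_space V -> weakly_measurable ip f ->
  (forall u, `|f u| <= t) -> 0 <= w -> w * t <= 1 / 2 -> 0 <= beta ->
  (forall e, `|\int[mu]_u ip (f u) e| <= beta * `|e|) ->
  (\int[mu]_u (`|f u| ^+ 2)) <= sig2 ->
  (\int[mu]_u (coshR `|s + w *: f u|)%:E <=
   (coshR `|s| * expR (w * beta + 2 * w ^+ 2 * sig2))%:E)%E.
Proof.
move=> ipP sV mf ft w0 wt b0 hb hs.
have mnf := wmeas_norm ipP sV mf.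
pose C := coshR `|s|; pose kp := sinhR `|s| / `|s|.
have C1 : 1 <= C by exact: coshR_ge1.
have sh0 : 0 <= sinhR `|s| by apply: le_trans (sinhR_ge _).
have kp0 : 0 <= kp by rewrite divr_ge0.
(* Only the two moments controlled by [beta] and [sig2] occur in this majorant. *)
pose g u := C + kp * w * ip (f u) s + 2 * C * w ^+ 2 * `|f u| ^+ 2.
have pw u : coshR `|s + w *: f u| <= g u.
  apply: (le_trans (coshR_normD_le ipP _ _)).
  rewrite /g -/C -/kp (ipZr ipP) (ipC ipP s) mulrA lerD2l.
  rewrite normrZ (ger0_norm w0).
  have y1 : w * `|f u| <= 1 / 2 by apply: le_trans wt; rewrite ler_wpM2l.
  have := expR_quad (mulr_ge0 w0 (normr_ge0 (f u))) y1.
  rewrite exprMn => h.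
  apply: (@le_trans _ _ (C * (2 * (w ^+ 2 * `|f u| ^+ 2)))); last by rewrite le_eqVlt; apply/orP; left; apply/eqP; ring.
  by rewrite ler_wpM2l// (le_trans _ C1).
have t0 : 0 <= t by apply: le_trans (ft point); exact: normr_ge0.
have i1 : mu.-integrable setT (EFin \o (fun u => ip (f u) s)).
  apply: (@bounded_integrable _ (t * `|s|)); first exact: mf.
  by move=> u; apply: (le_trans (ip_CS ipP _ _)); rewrite ler_wpM2r.
have i2 : mu.-integrable setT (EFin \o (fun u => `|f u| ^+ 2)).
  apply: (@bounded_integrable _ (t ^+ 2)); first exact: measurable_funX.
  by move=> u; rewrite ger0_norm ?sqr_ge0// lerXn2r// ?nnegrE.
have ic : mu.-integrable setT (EFin \o (fun=> C)) by apply: finite_measure_integrable_cst.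
have i1' : mu.-integrable setT (EFin \o (fun u => kp * w * ip (f u) s)).
  exact: (integrableZl _ _ i1).
have i2' : mu.-integrable setT (EFin \o (fun u => 2 * C * w ^+ 2 * `|f u| ^+ 2)).
  exact: (integrableZl _ _ i2).
have i3 : mu.-integrable setT (EFin \o (fun u => C + kp * w * ip (f u) s)).
  exact: (integrableD _ ic i1').
have ig : mu.-integrable setT (EFin \o g) by exact: (integrableD _ i3 i2').
apply: (@le_trans _ _ (\int[mu]_u (g u)%:E)%E).
  apply: ge0_le_integral => //.
  - by move=> u _; rewrite lee_fin (le_trans _ (coshR_ge1 _)).
  - apply/measurable_EFinP; apply: (measurableT_comp measurable_coshR).
    apply: (wmeas_norm ipP sV); apply: (wmeasD ipP) => //.
    by apply: (wmeasZ ipP).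
  - by have /integrableP[] := ig.
  - by move=> u _; rewrite lee_fin.
rewrite EFin_Rintegral// lee_fin /g RintegralD// RintegralD//.
rewrite Rintegral_cst// !RintegralZl// [X in fine X](_ : _ = 1%E); last exact: probability_setT.
rewrite mulr1.
have kps : kp * `|s| <= C.
  rewrite /kp; have [->|s0] := eqVneq s 0; first by rewrite normr0 mulr0 (le_trans _ C1).
  by rewrite divfK ?normr_eq0//; exact: sinhR_le_coshR.
have I1 : kp * w * \int[mu]_u ip (f u) s <= C * (w * beta).
  apply: (@le_trans _ _ (kp * w * (beta * `|s|))).
    by rewrite ler_wpM2l ?mulr_ge0// (le_trans (ler_norm _)).
  rewrite (_ : kp * w * (beta * `|s|) = (kp * `|s|) * (w * beta)); last by ring.
  by rewrite ler_wpM2r// mulr_ge0.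
have C0 : 0 <= C by rewrite (le_trans _ C1).
have I2 : 2 * C * w ^+ 2 * \int[mu]_u (`|f u| ^+ 2) <= C * (2 * w ^+ 2 * sig2).
  rewrite (_ : C * (2 * w ^+ 2 * sig2) = 2 * C * w ^+ 2 * sig2); last by ring.
  by rewrite ler_wpM2l// !mulr_ge0// sqr_ge0.
apply: (le_trans (lerD (lerD (lexx C) I1) I2)).
rewrite (_ : C + _ + _ = C * (1 + (w * beta + 2 * w ^+ 2 * sig2))); last by ring.
rewrite ler_wpM2l//.
exact: expR_ge1Dx.
Qed.

End probability_bounds.

(** * The sequence space, shifts and renewal *)

Definition seq_drop (S : Type) (l : nat) (u : nat -> S) : nat -> S :=
  fun j => u (l + j)%N.

(** The tail restarts [u'] at its coordinate 0, so that dropping [m] coordinates recovers all of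
    [u']. *)
Definition seq_mix (S : Type) (m : nat) (u u' : nat -> S) : nat -> S :=
  fun j => if (j < m)%N then u j else u' (j - m)%N.

Notation seq_space S := (g_sigma_algebraType (@cylinders _ S)).

Section sequence_space.
Context {dS : measure_display} {S : measurableType dS}.

Lemma seq_drop0 (u : nat -> S) : seq_drop 0 u = u.
Proof. by apply/funext => j; rewrite /seq_drop add0n. Qed.

Lemma seq_dropD k l (u : nat -> S) : seq_drop k (seq_drop l u) = seq_drop (l + k) u.
Proof. by apply/funext => j; rewrite /seq_drop addnA. Qed.

Lemma seq_drop_mix m l (u u' : nat -> S) :
  seq_drop (m + l) (seq_mix m u u') = seq_drop l u'.
Proof.
apply/funext => j; rewrite /seq_drop /seq_mix -addnA ltnNge leq_addr/=.
by rewrite addnC addnK.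
Qed.

Lemma seq_mix_mix m (u u' u'' : nat -> S) :
  seq_mix m (seq_mix m u u') u'' = seq_mix m u u''.
Proof. by apply/funext => j; rewrite /seq_mix; case: (j < m)%N. Qed.

Lemma measurable_coord j : measurable_fun setT (fun u : seq_space S => u j).
Proof.
move=> _ A mA; rewrite setTI; apply: sub_sigma_algebra.
by exists j, A.
Qed.

Lemma measurable_seqP d (T : measurableType d) (f : T -> seq_space S) :
  (forall j, measurable_fun setT (fun t => f t j)) -> measurable_fun setT f.
Proof.
move=> mf; apply: (@measurability _ _ T (seq_space S) setT f (@cylinders _ S)) => //.
move=> _ [_ [j [A [mA ->]]] <-].
exact: (mf j).
Qed.

Lemma measurable_seq_drop l :
  measurable_fun setT (seq_drop l : seq_space S -> seq_space S).
Proof. by apply: measurable_seqP => j; exact: measurable_coord. Qed.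

Lemma measurable_seq_mix m d (T : measurableType d) (f g : T -> seq_space S) :
  measurable_fun setT f -> measurable_fun setT g ->
  measurable_fun setT (fun t => seq_mix m (f t) (g t) : seq_space S).
Proof.
move=> mf mg; apply: measurable_seqP => j; rewrite /seq_mix.
by case: (j < m)%N; [apply: (measurableT_comp (measurable_coord j))|
  apply: (measurableT_comp (measurable_coord (j - m)))].
Qed.

End sequence_space.

(* [mu] behaves as the law of an i.i.d. sequence: it is invariant under replacing
   the tail from any index on by an independent copy. *)
Definition renewable (R : realType) dS (S : measurableType dS)
    (mu : probability (seq_space S) R) : Prop :=
  forall m (F : seq_space S -> \bar R), measurable_fun setT F ->
    (forall u, 0 <= F u)%E ->
    (\int[mu]_u F u = \int[mu]_u' \int[mu]_u F (seq_mix m u u'))%E.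

(** * Exponential moments of sums of m-dependent vectors *)

Section exponential_inequality.
Context {R : realType} {V : normedModType R} {ip : V -> V -> R}.
Hypothesis ipP : is_inner_product ip.
Hypothesis sV : separable_space V.
Context {dS : measure_display} {S : measurableType dS}.
Local Notation U := (seq_space S).
Variable mu : probability U R.
Hypothesis mu_renew : renewable mu.

(** Stationarity follows from renewal: the shifted mixture is [u'] itself, so the inner integral is
    that of a constant. *)
Lemma integral_seq_drop m (F : U -> \bar R) : measurable_fun setT F ->
  (forall u, 0 <= F u)%E ->
  (\int[mu]_u F (seq_drop m u) = \int[mu]_u F u)%E.
Proof.
move=> mF F0.
rewrite (@mu_renew m (fun u => F (seq_drop m u)))//; last first.
  exact: (measurableT_comp mF (measurable_seq_drop m)).
apply: eq_integral => u' _.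
under eq_integral => u _ do rewrite -[X in seq_drop X](addn0 m) seq_drop_mix seq_drop0.
have mu1 : mu setT = 1%E by exact: probability_setT.
by rewrite integral_cst// [X in (_ * X)%E]mu1 mule1.
Qed.

(** If [f] reads only [m] coordinates, the summands read disjoint blocks. *)
Definition block_sum m (f : U -> V) (w : nat -> R) Q (u : U) : V :=
  \sum_(q < Q) w q *: f (seq_drop (q * m) u).

Lemma wmeas_block_sum m f w Q : weakly_measurable ip f ->
  weakly_measurable ip (block_sum m f w Q).
Proof.
move=> mf; apply: (wmeas_sum ipP) => q; apply: (wmeasZ ipP) => //.
exact: (wmeas_comp mf (@measurable_seq_drop _ _ _)).
Qed.

Lemma block_sum_mix m f w Q (u u' : U) :
  (forall u u', f (seq_mix m u u') = f u) ->
  block_sum m f w Q.+1 (seq_mix m u u') =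
  block_sum m f (fun q => w q.+1) Q u' + w 0%N *: f u.
Proof.
move=> fm; rewrite /block_sum big_ord_recl/= mul0n seq_drop0 fm addrC; congr (_ + _).
by apply: eq_bigr => q _; rewrite /bump/= add1n mulSn seq_drop_mix.
Qed.

(** Independence enters only through [mu_renew]: the first block is integrated while the sum over
    the later blocks is frozen as the vector [s] of the one-step bound. The induction shifts the
    weights, hence their generality. *)
Lemma integral_coshR_block_sum m (f : U -> V) t beta sig2 Q (w : nat -> R) :
  weakly_measurable ip f -> (forall u u', f (seq_mix m u u') = f u) ->
  (forall u, `|f u| <= t) -> 0 <= beta ->
  (forall e, `|\int[mu]_u ip (f u) e| <= beta * `|e|) ->
  (\int[mu]_u (`|f u| ^+ 2)) <= sig2 ->
  (forall q, 0 <= w q) -> (forall q, w q * t <= 1 / 2) ->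
  (\int[mu]_u (coshR `|block_sum m f w Q u|)%:E <=
   (expR (\sum_(q < Q) (w q * beta + 2 * w q ^+ 2 * sig2)))%:E)%E.
Proof.
move=> mf fm ft b0 hb hs; elim: Q w => [|Q IH] w w0 wt.
  under eq_integral do rewrite /block_sum big_ord0 normr0.
  by rewrite integral_cst_prob big_ord0 /coshR oppr0 expR0; rewrite lee_fin; lra.
have mcn (g : U -> V) : weakly_measurable ip g ->
    measurable_fun setT (fun u => (coshR `|g u|)%:E).
  move=> mg; apply/measurable_EFinP; apply: (measurableT_comp (@measurable_coshR R)).
  exact: (wmeas_norm ipP sV).
have c0 v : (0 <= (coshR v : R)%:E)%E by rewrite lee_fin (le_trans _ (coshR_ge1 _)).
rewrite (mu_renew m)//; last by apply: mcn; exact: wmeas_block_sum.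
pose E0 := expR (w 0%N * beta + 2 * w 0%N ^+ 2 * sig2).
apply: (@le_trans _ _ (\int[mu]_u' (E0%:E * (coshR `|block_sum m f (fun q => w q.+1) Q u'|)%:E))%E).
  apply: ge0_le_integral => //.
  - by move=> u' _; exact: integral_ge0.
  - pose F (p : U * U) := (coshR `|block_sum m f w Q.+1 (seq_mix m p.1 p.2)|)%:E.
    apply: (@measurable_fun_fubini_tonelli_G _ _ _ _ _ mu F); last by move=> p; exact: c0.
    apply: (measurableT_comp (mcn _ (wmeas_block_sum m w Q.+1 mf))).
    by apply: measurable_seq_mix.
  - apply: measurable_funeM; apply: mcn; exact: wmeas_block_sum.
  - move=> u' _.
    under eq_integral do rewrite block_sum_mix//.
    rewrite -EFinM mulrC.
    apply: (@integral_coshR_normD _ _ _ mu _ ip f _ (w 0%N) t beta sig2) => //.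
rewrite ge0_integralZl//; last 2 first.
- by apply: mcn; exact: wmeas_block_sum.
- by rewrite lee_fin expR_ge0.
rewrite big_ord_recl/= expRD EFinM; apply: lee_wpmul2l; first by rewrite lee_fin expR_ge0.
exact: IH.
Qed.

(** Taking [n] rows of length [m] overshoots [n] but avoids rounding; where this is used, the
    surplus terms vanish. *)
Lemma sum_residues (Z : zmodType) (G : nat -> Z) n m :
  \sum_(l < n * m) G l = \sum_(g < m) \sum_(q < n) G (q * m + g)%N.
Proof.
rewrite exchange_big/=; elim: n => [|n IH]; first by rewrite mul0n !big_ord0.
rewrite big_ord_recr/= -IH mulSn addnC -!(big_mkord xpredT) (@big_cat_nat _ _ _ (n * m)%N)//=; last exact: leq_addr.
congr (_ + _); rewrite -{1}(add0n (n * m)%N) big_addn addnC addnK big_mkord.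
by apply: eq_bigr => g _; rewrite addnC.
Qed.

(** Jensen over the [m] residue classes multiplies the weights by [m]. This gives the factor [m] in
    the condition on [lam] and the [m ^ 2] next to [c2] in the exponent. The variance of each class
    is bounded by that of the whole sum. *)
Lemma integral_expR_weighted_sum n m (f : U -> V) t beta sig2 lam drift c2 (w : nat -> R) :
  (0 < m)%N -> weakly_measurable ip f -> (forall u u', f (seq_mix m u u') = f u) ->
  (forall u, `|f u| <= t) -> 0 <= beta ->
  (forall e, `|\int[mu]_u ip (f u) e| <= beta * `|e|) ->
  (\int[mu]_u (`|f u| ^+ 2)) <= sig2 -> 0 <= sig2 ->
  (forall l, 0 <= w l) -> (forall l, (n <= l)%N -> w l = 0) -> 0 <= lam ->
  (forall l, lam * m%:R * w l * t <= 1 / 2) ->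
  (forall g, (g < m)%N -> m%:R * (\sum_(q < n) w (q * m + g)%N) * beta <= drift) ->
  \sum_(l < n) w l ^+ 2 <= c2 ->
  (\int[mu]_u (expR (lam * `|\sum_(l < n) w l *: f (seq_drop l u)|))%:E <=
   (2 * expR (lam * drift + 2 * lam ^+ 2 * m%:R ^+ 2 * sig2 * c2))%:E)%E.
Proof.
move=> m0 mf fm ft b0 hb hs s0 w0 wn lam0 lwt hd hc.
have mR : (0 : R) < m%:R by rewrite ltr0n.
have nm : (n <= n * m)%N by rewrite leq_pmulr.
pose wg g q : R := lam * m%:R * w (q * m + g)%N.
pose Sg g (u : U) := block_sum m f (wg g) n (seq_drop g u).
have sumE (u : U) : \sum_(l < n) w l *: f (seq_drop l u) =
    \sum_(g < m) \sum_(q < n) w (q * m + g)%N *: f (seq_drop (q * m + g) u).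
  rewrite -(sum_residues (fun l => w l *: f (seq_drop l u))).
  rewrite -!(big_mkord xpredT (fun l => w l *: f (seq_drop l u))) (@big_cat_nat _ _ _ n 0 (n * m))//=.
  rewrite [X in _ = _ + X]big_nat_cond [X in _ = _ + X]big1 ?addr0// => l /andP[/andP[nl _] _].
  by rewrite wn// scale0r.
have pw (u : U) : expR (lam * `|\sum_(l < n) w l *: f (seq_drop l u)|) <=
    2 / m%:R * \sum_(g < m) coshR `|Sg g u|.
  pose s (g : nat) : R := lam * `|\sum_(q < n) w (q * m + g)%N *: f (seq_drop (q * m + g) u)|.
  apply: (@le_trans _ _ (expR (\sum_(g < m) s g))).
    rewrite ler_expR /s -mulr_sumr ler_wpM2l// sumE.
    exact: ler_norm_sum.
  apply: (le_trans (expR_sum_le s m0)).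
  rewrite [leRHS](_ : _ = m%:R^-1 * \sum_(g < m) (2 * coshR `|Sg g u|)); last by rewrite -mulr_sumr; field; rewrite gt_eqF.
  rewrite ler_pM2l ?invr_gt0//; apply: ler_sum => g _.
  apply: (le_trans _ (expR_le_coshR _)); rewrite ler_expR le_eqVlt; apply/orP; left; apply/eqP.
  rewrite /s /Sg /block_sum.
  transitivity (`|(lam * m%:R) *: \sum_(q < n) w (q * m + g)%N *: f (seq_drop (q * m + g) u)|).
    by rewrite normrZ ger0_norm ?mulr_ge0//; ring.
  rewrite scaler_sumr; congr (`| _ |).
  by apply: eq_bigr => q _; rewrite seq_dropD (addnC g) scalerA.
have mS g : measurable_fun setT (fun u : U => (coshR `|Sg g u|)%:E).
  apply/measurable_EFinP; apply: (measurableT_comp (@measurable_coshR R)).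
  apply: (wmeas_norm ipP sV); apply: (wmeas_comp _ (measurable_seq_drop g)).
  exact: wmeas_block_sum.
have c0 v : (0 <= (coshR v : R)%:E)%E by rewrite lee_fin (le_trans _ (coshR_ge1 _)).
pose bd := lam * drift + 2 * lam ^+ 2 * m%:R ^+ 2 * sig2 * c2.
have Sbd g : (g < m)%N -> (\int[mu]_u (coshR `|Sg g u|)%:E <= (expR bd)%:E)%E.
  move=> gm; rewrite /Sg (@integral_seq_drop g (fun u => (coshR `|block_sum m f (wg g) n u|)%:E))//; last first.
    apply/measurable_EFinP; apply: (measurableT_comp (@measurable_coshR R)).
    by apply: (wmeas_norm ipP sV); exact: wmeas_block_sum.
  apply: (le_trans (integral_coshR_block_sum n mf fm ft b0 hb hs _ _)).
  - by move=> q; rewrite /wg !mulr_ge0// ltW.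
  - by move=> q; exact: lwt.
  rewrite lee_fin ler_expR big_split/= /bd; apply: lerD.
    rewrite -mulr_suml /wg -mulr_sumr -!mulrA ler_wpM2l// mulrA; exact: hd.
  have -> : \sum_(q < n) 2 * wg g q ^+ 2 * sig2 =
     2 * lam ^+ 2 * m%:R ^+ 2 * sig2 * \sum_(q < n) w (q * m + g)%N ^+ 2.
    by rewrite mulr_sumr; apply: eq_bigr => q _; rewrite /wg; ring.
  rewrite ler_wpM2l ?mulr_ge0 ?sqr_ge0//; apply: le_trans hc.
  have : \sum_(l < n) w l ^+ 2 = \sum_(l < n * m) w l ^+ 2.
    rewrite -!(big_mkord xpredT (fun l => w l ^+ 2)) (@big_cat_nat _ _ _ n 0 (n * m))//=.
    rewrite [X in _ = _ + X]big_nat_cond [X in _ = _ + X]big1 ?addr0// => l /andP[/andP[nl _] _].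
    by rewrite wn// expr0n.
  move=> ->; rewrite (sum_residues (fun l => w l ^+ 2)) (bigD1 (Ordinal gm))//= lerDl.
  by apply: sumr_ge0 => ? _; apply: sumr_ge0 => ? _; exact: sqr_ge0.
apply: (@le_trans _ _ (\int[mu]_u ((2 / m%:R)%:E * \sum_(g < m) (coshR `|Sg g u|)%:E))%E).
  apply: ge0_le_integral => //.
  - apply/measurable_EFinP; apply: (measurableT_comp (@measurable_expR R)).
    apply: measurable_funM => //; apply: (wmeas_norm ipP sV).
    apply: (wmeas_sum ipP) => l; apply: (wmeasZ ipP) => //.
    exact: (wmeas_comp mf (@measurable_seq_drop _ _ _)).
  - by apply: measurable_funeM; apply: emeasurable_sum => g; exact: mS.
  - by move=> u _; rewrite sumEFin -EFinM lee_fin.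
rewrite ge0_integralZl//; last 2 first.
- by apply: emeasurable_sum => g; exact: mS.
- by move=> u _; apply: sume_ge0 => g _; exact: c0.
rewrite ge0_integral_sum//.
rewrite [leRHS](_ : _ = ((2 / m%:R)%:E * \sum_(g < m) (expR bd)%:E)%E).
  apply: lee_wpmul2l; first by rewrite lee_fin divr_ge0.
  by apply: lee_sum => g _; exact: Sbd.
rewrite sumEFin sumr_const card_ord -EFinM -(mulr_natr (expR bd) m) -/bd; congr (_%:E).
by field; rewrite gt_eqF.
Qed.

End exponential_inequality.

(** * Affine bounds for integrals and a mean value argument *)

Section integral_bounds.
Context {R : realType} {d : measure_display} {T : measurableType d}.
Variable mu : probability T R.

Lemma integral_le_affine (f g : T -> R) (A B c : R) : 0 <= A -> 0 <= B ->
  measurable_fun setT f -> measurable_fun setT g -> (forall u, 0 <= f u) ->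
  (forall u, 0 <= g u) -> (forall u, f u <= A * (B + g u)) ->
  (\int[mu]_u (g u)%:E <= c%:E -> \int[mu]_u (f u)%:E <= (A * (B + c))%:E)%E.
Proof.
move=> A0 B0 mf mg f0 g0 fg gc.
have mgE : measurable_fun setT (fun u => (g u)%:E) by exact/measurable_EFinP.
apply: (@le_trans _ _ (\int[mu]_u (A%:E * (B%:E + (g u)%:E)))%E).
  apply: ge0_le_integral => //.
  - by move=> u _; rewrite lee_fin.
  - exact/measurable_EFinP.
  - by apply: measurable_funeM; apply: emeasurable_funD.
  - by move=> u _; rewrite -EFinD -EFinM lee_fin.
rewrite ge0_integralZl//; last 2 first.
- by apply: emeasurable_funD.
- by move=> u _; rewrite adde_ge0// lee_fin.
rewrite ge0_integralD//; last by move=> u _; rewrite lee_fin.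
rewrite integral_cst_prob EFinM; apply: lee_wpmul2l; first by rewrite lee_fin.
by rewrite EFinD leeD2l.
Qed.

Lemma exists_le_mean (G : T -> \bar R) (c : R) : measurable_fun setT G ->
  (forall u, 0 <= G u)%E -> (\int[mu]_u G u < c%:E)%E -> exists u, (G u <= c%:E)%E.
Proof.
move=> mG G0 Gc; apply: contrapT => /forallNP h.
have c0 : (0 <= c%:E)%E by apply: le_trans (ltW Gc); exact: integral_ge0.
have : (\int[mu]_u c%:E <= \int[mu]_u G u)%E.
  by apply: ge0_le_integral => // u _; apply: ltW; rewrite ltNge; exact/negP/h.
by rewrite integral_cst_prob leNgt Gc.
Qed.

End integral_bounds.

Lemma sum_ltn (R : pzSemiRingType) n K : \sum_(q < n) ((q < K)%N%:R : R) = (minn n K)%:R.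
Proof.
elim: n => [|n IH]; first by rewrite big_ord0 min0n.
by rewrite big_ord_recr/= IH -natrD; congr (_%:R); lia.
Qed.

(** * Growth of the Young function *)

Section young_function.
Context {R : realType}.
Variables (psi phi : R -> R) (C0 rr : R).
Hypothesis psi0 : psi 0 = 0.
Hypothesis psi_mono : forall s t, 0 <= s -> s <= t -> psi s <= psi t.
Hypothesis psi_convex : forall s t l, 0 <= s -> 0 <= t -> 0 <= l -> l <= 1 ->
  psi (l * s + (1 - l) * t) <= l * psi s + (1 - l) * psi t.
Hypothesis C00 : 0 < C0.
Hypothesis rr2 : 2 <= rr.
Hypothesis phi0 : phi 0 = 0.
Hypothesis phi1 : phi 1 = 1.
Hypothesis phi_mono : forall s t, 0 <= s -> s <= t -> phi s <= phi t.
Hypothesis phi_concave : forall s t l, 0 <= s -> 0 <= t -> 0 <= l -> l <= 1 ->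
  l * phi s + (1 - l) * phi t <= phi (l * s + (1 - l) * t).
Hypothesis growth : forall t, 0 <= t -> t `^ rr <= phi (psi (C0 * t)).

Lemma young_ge0 t : 0 <= t -> 0 <= psi t.
Proof. by move=> t0; rewrite -psi0; exact: psi_mono. Qed.

(** Concavity through the values 0 at 0 and 1 at 1 puts [phi] below the identity beyond 1;
    monotonicity bounds it by 1 before. *)
Lemma concave_le_1D s : 0 <= s -> phi s <= 1 + s.
Proof.
move=> s0; have [s1|/ltW s1] := leP s 1.
  by apply: (le_trans (phi_mono s0 s1)); rewrite phi1; lra.
have sp : 0 < s by apply: lt_le_trans s1.
have := @phi_concave s 0 s^-1 s0 (lexx _); rewrite invr_ge0 => /(_ s0).
rewrite invf_le1// => /(_ s1); rewrite mulVf ?gt_eqF// phi0 !mulr0 !addr0 phi1.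
rewrite ler_pdivrMl// mulr1; lra.
Qed.

Lemma powR_le_young t : 0 <= t -> t `^ rr <= 1 + psi (C0 * t).
Proof.
move=> t0; apply: (le_trans (growth t0)); apply: concave_le_1D.
by apply: young_ge0; rewrite mulr_ge0// ltW.
Qed.

(** Through [2 <= rr] the function [psi] controls second moments, which serve as variance proxy. *)
Lemma sqr_le_young t : 0 <= t -> t ^+ 2 <= 2 + psi (C0 * t).
Proof.
move=> t0; have p0 : 0 <= psi (C0 * t) by rewrite young_ge0// mulr_ge0// ltW.
have [t1|/ltW t1] := leP t 1; first by nra.
have := powR_le_young t0; have : t `^ 2 <= t `^ rr by rewrite ler_powR.
rewrite powR_mulrn//; lra.
Qed.

Lemma sqr_le_young_scaled y c : 0 <= y -> 0 < c ->
  y ^+ 2 <= (C0 * c) ^+ 2 * (2 + psi (y / c)).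
Proof.
move=> y0 c0; have Cc : 0 < C0 * c by rewrite mulr_gt0.
have := @sqr_le_young (y / (C0 * c)); rewrite divr_ge0// ?(ltW Cc)// => /(_ isT).
have -> : C0 * (y / (C0 * c)) = y / c by field; rewrite !gt_eqF.
by rewrite expr_div_n ler_pdivrMr ?exprn_gt0// mulrC.
Qed.

Lemma le_young_scaled y c : 0 <= y -> 0 < c -> y <= C0 * c * (2 + psi (y / c)).
Proof.
move=> y0 c0; have Cc : 0 < C0 * c by rewrite mulr_gt0.
have pos : 0 <= psi (y / c) by rewrite young_ge0// divr_ge0// ltW.
have := @powR_le_young (y / (C0 * c)); rewrite divr_ge0// ?(ltW Cc)// => /(_ isT).
have -> : C0 * (y / (C0 * c)) = y / c by field; rewrite !gt_eqF.
move=> h; rewrite mulrC -ler_pdivrMr//.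
have [t1|/ltW t1] := leP (y / (C0 * c)) 1; first by lra.
have : (y / (C0 * c)) `^ 1 <= (y / (C0 * c)) `^ rr.
  by apply: ler_powR => //; apply: le_trans rr2; lra.
rewrite powRr1; last by rewrite divr_ge0// ltW.
lra.
Qed.

(** Monotonicity and convexity alone would allow [psi] to vanish near 0; the growth condition
    forbids it because [phi 0 = 0]. *)
Lemma young_gt0 t : 0 < t -> 0 < psi t.
Proof.
move=> t0; rewrite lt_neqAle young_ge0 ?ltW// andbT eq_sym; apply/eqP => pt.
have := growth (ltW (divr_gt0 t0 C00)).
have -> : C0 * (t / C0) = t by field; rewrite gt_eqF.
by rewrite pt phi0 leNgt powR_gt0// divr_gt0.
Qed.

Lemma young_unbounded A : exists2 x : R, 0 < x & A <= psi x.
Proof.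
exists (C0 * 1 * (2 + `|A|)); first by rewrite !mulr_gt0// ltr_wpDr.
have y0 : 0 <= C0 * 1 * (2 + `|A|) by rewrite !mulr_ge0// ?ltW//; apply: ltr_wpDr.
have := le_young_scaled y0 (@ltr01 R); rewrite divr1 ler_pM2l ?mulr_gt0//.
have := ler_norm A; lra.
Qed.

(** With [A = 1 + psi (y / c)], growth gives [y / (C0 * c) <= A ^ (1 / rr)], and [t < y] gives [psi
    (t / c) ^ (1 - 1 / rr) <= A ^ (1 - 1 / rr)]. Their product is the claim; this is the source of
    the exponent in the third series. *)
Lemma tail_le_young y t c : 0 < t -> t < y -> 0 < c ->
  y <= C0 * c / psi (t / c) `^ (1 - rr^-1) * (1 + psi (y / c)).
Proof.
move=> t0 ty c0; have Cc : 0 < C0 * c by rewrite mulr_gt0.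
have y0 : 0 < y by apply: lt_trans ty.
have rr0 : 0 < rr by apply: lt_le_trans rr2.
have ri1 : 0 <= 1 - rr^-1 by rewrite subr_ge0 invf_le1//; apply: le_trans rr2; lra.
have ptp : 0 < psi (t / c) by rewrite young_gt0// divr_gt0.
have pos : 0 <= psi (y / c) by rewrite young_ge0// divr_ge0// ltW.
set s := y / (C0 * c); have s0 : 0 <= s by rewrite divr_ge0// ltW.
have := powR_le_young s0; rewrite /s.
have -> : C0 * (y / (C0 * c)) = y / c by field; rewrite !gt_eqF.
rewrite -/s => h; set A := 1 + psi (y / c) in h *.
have A0 : 0 < A by rewrite ltr_wpDr.
have sA : s <= A `^ rr^-1.
  have -> : s = (s `^ rr) `^ rr^-1 by rewrite -powRrM divff ?gt_eqF// powRr1.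
  by apply: ge0_ler_powR => //; rewrite ?nnegrE ?powR_ge0 ?invr_ge0 ?ltW.
have pA : psi (t / c) `^ (1 - rr^-1) <= A `^ (1 - rr^-1).
  apply: ge0_ler_powR => //; rewrite ?nnegrE ?(ltW ptp) ?(ltW A0)//.
  apply: (@le_trans _ _ (psi (y / c))); last by rewrite /A; lra.
  apply: psi_mono; first by rewrite divr_ge0// ltW.
  by rewrite ler_pM2r ?invr_gt0// ltW.
have sp : s * psi (t / c) `^ (1 - rr^-1) <= A.
  apply: (le_trans (ler_pM s0 (powR_ge0 _ _) sA pA)).
  rewrite -powRD; last by rewrite (gt_eqF A0) implybT.
  by rewrite addrC subrK powRr1// ltW.
have -> : y = C0 * c * s by rewrite /s; field; rewrite !gt_eqF.
by rewrite -(mulrA (C0 * c)) (ler_pM2l Cc) ler_pdivlMl ?powR_gt0// mulrC.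
Qed.

(** Convexity and [psi 0 = 0] make [psi y / y] nondecreasing, which settles [x <= y]. Averaged over
    the weights, it turns a bound on the mean of [psi] into one on the mean itself, so Markov's
    inequality can be applied to [psi]. *)
Lemma le_young_ratio x y : 0 < x -> 0 <= y -> y <= x * (1 + psi y / psi x).
Proof.
move=> x0 y0; have px := young_gt0 x0; have py := young_ge0 y0.
have [yx|/ltW xy] := leP y x.
  by apply: (le_trans yx); rewrite ler_peMr ?(ltW x0)// lerDl divr_ge0// ltW.
have yp : 0 < y by apply: lt_le_trans xy.
have := @psi_convex y 0 (x / y) y0 (lexx _); rewrite divr_ge0 ?(ltW x0)//.
rewrite ler_pdivrMr// mul1r => /(_ isT xy); rewrite psi0 !mulr0 !addr0 divfK ?gt_eqF//.
move=> h; apply: (@le_trans _ _ (x * (psi y / psi x))); last by rewrite ler_pM2l//; lra.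
rewrite mulrA ler_pdivlMr//.
have := ler_wpM2l y0 h; rewrite mulrA mulrCA divff ?gt_eqF// mulr1; lra.
Qed.

(** Nothing is known about [psi] on negative numbers; precomposing with the maximum with 0 gives a
    function monotone on the whole line. *)
Lemma measurable_young d (T : measurableType d) (f : T -> R) :
  measurable_fun setT f -> (forall u, 0 <= f u) -> measurable_fun setT (fun u => psi (f u)).
Proof.
move=> mf f0.
have -> : (fun u => psi (f u)) = (fun x => psi (Num.max 0 x)) \o f.
  by apply/funext => u /=; rewrite max_r.
apply: (measurableT_comp _ mf); apply: nondecreasing_measurable => // a b ab.
apply: psi_mono; first by rewrite le_max lexx.
by rewrite ge_max le_max lexx/= le_max ab orbT.
Qed.

(** * Tail bound for the weighted noise at a fixed sample size *)

Section noise_tail.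
Context {V : normedModType R} {ip : V -> V -> R}.
Hypothesis ipP : is_inner_product ip.
Hypothesis sV : separable_space V.
Context {dS : measure_display} {S : measurableType dS}.
Local Notation U := (seq_space S).
Variable mu : probability U R.
Hypothesis mu_renew : renewable mu.
Variable h : U -> V.
Hypothesis mh : weakly_measurable ip h.
Hypothesis h_centered : forall e, mu.-integrable setT (fun u => (ip (h u) e)%:E) /\
  (\int[mu]_u (ip (h u) e)%:E = 0)%E.
Variables (n m : nat) (w : nat -> R) (v1 delta M t : R).
Hypothesis m0 : (0 < m)%N.
Hypothesis mn : (m <= n)%N.
Hypothesis w0 : forall l, 0 <= w l.
Hypothesis wn : forall l, (n <= l)%N -> w l = 0.
Hypothesis w1 : \sum_(l < n) w l = 1.
Hypothesis wv : forall l, w l <= v1.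
Hypothesis delta0 : 0 < delta.
Hypothesis M0 : 0 < M.
Hypothesis t0 : 0 < t.
Hypothesis Hdelta :
  (\int[mu]_u' \int[mu]_u (psi (`|h u - h (seq_mix m u u')| / delta))%:E <= 1)%E.
Hypothesis HM : (\int[mu]_u (psi (`|h u| / M))%:E <= 1)%E.

Let psi_norm_ge0 (v : V) c : 0 < c -> 0 <= psi (`|v| / c).
Proof. by move=> c0; rewrite young_ge0// divr_ge0// ltW. Qed.

Let measurable_psi_norm d (T : measurableType d) (f : T -> V) c : 0 < c ->
  weakly_measurable ip f -> measurable_fun setT (fun u => psi (`|f u| / c)).
Proof.
move=> c0 mf; apply: measurable_young.
  by apply: measurable_funM => //; exact: (wmeas_norm ipP sV).
by move=> u; rewrite divr_ge0// ltW.
Qed.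

(** Both integrals, averaged over the filler, are at most 1; for the second this is renewal applied
    to [HM]. Their sum has mean at most 2, hence is at most 3 at some filler, and there each term is
    at most 3. *)
Lemma filler_exists : exists u0 : U,
  (\int[mu]_u (psi (`|h u - h (seq_mix m u u0)| / delta))%:E <= 3%:E)%E /\
  (\int[mu]_u (psi (`|h (seq_mix m u u0)| / M))%:E <= 3%:E)%E.
Proof.
pose F1 (p : U * U) := (psi (`|h p.1 - h (seq_mix m p.1 p.2)| / delta))%:E.
pose F2 (p : U * U) := (psi (`|h (seq_mix m p.1 p.2)| / M))%:E.
have mmix : weakly_measurable ip (fun p : U * U => h (seq_mix m p.1 p.2)).
  by apply: (wmeas_comp mh); apply: measurable_seq_mix.
have mF1 : measurable_fun setT F1.
  apply/measurable_EFinP; apply: measurable_psi_norm => //.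
  by apply: (wmeasB ipP) => //; apply: (wmeas_comp mh).
have mF2 : measurable_fun setT F2.
  by apply/measurable_EFinP; apply: measurable_psi_norm.
have F10 p : (0 <= F1 p)%E by rewrite lee_fin psi_norm_ge0.
have F20 p : (0 <= F2 p)%E by rewrite lee_fin psi_norm_ge0.
pose G u' := (fubini_G mu F1 u' + fubini_G mu F2 u')%E.
have mG1 := @measurable_fun_fubini_tonelli_G _ _ _ _ _ mu F1 mF1 F10.
have mG2 := @measurable_fun_fubini_tonelli_G _ _ _ _ _ mu F2 mF2 F20.
have G10 u' : (0 <= fubini_G mu F1 u')%E by exact: integral_ge0.
have G20 u' : (0 <= fubini_G mu F2 u')%E by exact: integral_ge0.
have [||u0 Gu0] := @exists_le_mean _ _ _ mu G 3 (emeasurable_funD mG1 mG2).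
- by move=> u'; exact: adde_ge0.
- rewrite /G ge0_integralD//.
  apply: (@le_lt_trans _ _ (1 + 1)%E); last by rewrite -EFinD lte_fin; lra.
  apply: leeD; first exact: Hdelta.
  apply: le_trans HM; rewrite (mu_renew m)//.
    by apply/measurable_EFinP; exact: measurable_psi_norm.
  by move=> u; rewrite lee_fin psi_norm_ge0.
exists u0; split.
- by apply: le_trans Gu0; rewrite /G leeDl.
- by apply: le_trans Gu0; rewrite /G leeDr.
Qed.

Lemma integral_weighted_drop (g : U -> R) : measurable_fun setT g -> (forall u, 0 <= g u) ->
  (\int[mu]_u (\sum_(l < n) w l * g (seq_drop l u))%:E = \int[mu]_u (g u)%:E)%E.
Proof.
move=> mg g0.
have mgd l : measurable_fun setT (fun u : U => (g (seq_drop l u))%:E).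
  apply/measurable_EFinP; exact: (measurableT_comp mg (measurable_seq_drop l)).
transitivity (\int[mu]_u (\sum_(l < n) (w l)%:E * (g (seq_drop l u))%:E))%E.
  by apply: eq_integral => u _; rewrite -sumEFin.
rewrite ge0_integral_sum//; last 2 first.
- by move=> l; apply: measurable_funeM.
- by move=> l u _; rewrite -EFinM lee_fin mulr_ge0.
transitivity (\sum_(l < n) (w l)%:E * \int[mu]_u (g u)%:E)%E.
  apply: eq_bigr => l _; rewrite ge0_integralZl//; last by rewrite lee_fin.
    congr (_ * _)%E; apply: (@integral_seq_drop _ _ _ mu mu_renew l (fun u => (g u)%:E)).
      exact/measurable_EFinP.
    by move=> u; rewrite lee_fin.
  by move=> u _; rewrite lee_fin.
rewrite -ge0_sume_distrl; last by move=> l _; rewrite lee_fin.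
by rewrite sumEFin w1 mul1e.
Qed.

Let v10 : 0 <= v1. Proof. exact: le_trans (w0 0%N) (wv 0%N). Qed.

(** A residue class has at most [n %/ m + 1] indices below [n], and [m] times this number is at most
    [n + m <= 2 * n]. *)
Lemma residue_weight g : (g < m)%N ->
  m%:R * \sum_(q < n) w (q * m + g)%N <= 2 * n%:R * v1.
Proof.
move=> gm; pose K := (n %/ m).+1.
have le1 : \sum_(q < n) w (q * m + g)%N <= K%:R * v1.
  apply: (@le_trans _ _ (\sum_(q < n) ((q < K)%N%:R * v1))).
    apply: ler_sum => q _; case: ltnP => qK; first by rewrite mul1r.
    rewrite mul0r wn//; apply: (@leq_trans (K * m)).
      by rewrite ltnW// /K ltn_ceil.
    by apply: leq_trans (leq_addr _ _); rewrite leq_mul2r qK orbT.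
  by rewrite -mulr_suml sum_ltn ler_wpM2r// ler_nat geq_minr.
apply: (@le_trans _ _ (m%:R * (K%:R * v1))); first by rewrite ler_wpM2l.
rewrite mulrA ler_wpM2r// -!natrM ler_nat /K mulnS mulSn mul1n.
by rewrite leq_add// mulnC leq_trunc_div.
Qed.

(** Coupling error, excess over the truncation level and truncated part receive the allowances
    [2 * x * delta], [a] and [y]. With the 3 of the filler, coupling error and second moment carry
    the constant 5 = 2 + 3 and the excess carries 4 = 1 + 3; the 10s are 2 times 5, from
    [residue_weight] in the drift and from the quadratic remainder in the exponent. *)
Lemma noise_tail a x y lam c2 Psi drift : 0 < a -> 0 < x -> 0 <= lam ->
  lam * m%:R * v1 * t <= 1 / 2 -> \sum_(l < n) w l ^+ 2 <= c2 ->
  Psi = psi (t / M) `^ (1 - rr^-1) ->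
  drift = 10 * (n%:R * v1) * (C0 * delta) + 4 * m%:R * (C0 * M / Psi) ->
  (mu [set u : U | (2 * x * delta + a + y <= `|\sum_(l < n) w l *: h (seq_drop l u)|)%R] <=
   (3 / psi x + 4 * C0 * M / Psi / a +
    2 * expR (lam * drift + 10 * lam ^+ 2 * m%:R ^+ 2 * (C0 * M) ^+ 2 * c2 - lam * y))%:E)%E.
Proof.
move=> a0 x0 lam0 lamt hc2 PsiE driftE.
have [u0 [H1 H2]] := filler_exists.
have Psi0 : 0 < Psi by rewrite PsiE powR_gt0// young_gt0// divr_gt0.
pose hm (u : U) := h (seq_mix m u u0).
pose f := truncate t hm.
have mhm : weakly_measurable ip hm.
  by apply: (wmeas_comp mh); apply: measurable_seq_mix.
have mf : weakly_measurable ip f by apply: (wmeas_truncate ipP).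
have fm (u u' : U) : f (seq_mix m u u') = f u by rewrite /f /truncate /hm seq_mix_mix.
have ft u : `|f u| <= t by rewrite /f /truncate; case: ifP => // _; rewrite normr0 ltW.
pose D (u : U) := `|h u - hm u|.
pose Y (u : U) := if `|hm u| <= t then 0 else `|hm u|.
have mD : measurable_fun setT D by apply: (wmeas_norm ipP sV); apply: (wmeasB ipP).
have mnhm : measurable_fun setT (fun u => `|hm u|) by apply: (wmeas_norm ipP sV).
have mY : measurable_fun setT Y.
  by apply: measurable_fun_ifT => //; apply: measurable_fun_ler.
have D0 u : 0 <= D u by exact: normr_ge0.
have Y0 u : 0 <= Y u by rewrite /Y; case: ifP.
have mpD : measurable_fun setT (fun u => psi (D u / delta)).
  by apply: measurable_psi_norm => //; apply: (wmeasB ipP).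
have mpM : measurable_fun setT (fun u => psi (`|hm u| / M)) by apply: measurable_psi_norm.
have CD : 0 <= C0 * delta by rewrite mulr_ge0// ltW.
have CM : 0 <= C0 * M by rewrite mulr_ge0// ltW.
have ED : (\int[mu]_u (D u)%:E <= (C0 * delta * (2 + 3))%:E)%E.
  apply: (integral_le_affine CD _ mD mpD) => // [u|u]; first exact: psi_norm_ge0.
  exact: le_young_scaled.
have EY : (\int[mu]_u (Y u)%:E <= (C0 * M / Psi * (1 + 3))%:E)%E.
  have c0 : 0 <= C0 * M / Psi by rewrite divr_ge0// ltW.
  apply: (integral_le_affine c0 _ mY mpM) => // [u|u]; first exact: psi_norm_ge0.
  rewrite /Y; case: (leP `|hm u| t) => tY; last by rewrite PsiE; exact: tail_le_young.
  by rewrite mulr_ge0// addr_ge0// psi_norm_ge0.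
have E2 : (\int[mu]_u (`|f u| ^+ 2)%:E <= ((C0 * M) ^+ 2 * (2 + 3))%:E)%E.
  apply: (integral_le_affine (sqr_ge0 _) _ _ mpM) => //.
  - by apply: measurable_funX; apply: (wmeas_norm ipP sV).
  - by move=> u; exact: psi_norm_ge0.
  - move=> u; apply: le_trans (sqr_le_young_scaled (normr_ge0 (hm u)) M0).
    rewrite /f /truncate; case: ifP => // _; rewrite normr0 expr0n.
    exact: sqr_ge0.
have i2 : mu.-integrable setT (EFin \o (fun u => `|f u| ^+ 2)).
  apply: (@bounded_integrable _ _ _ _ _ (t ^+ 2)).
    by apply: measurable_funX; apply: (wmeas_norm ipP sV).
  by move=> u; rewrite ger0_norm ?sqr_ge0// lerXn2r// nnegrE// ltW.
pose beta := 5 * (C0 * delta) + 4 * (C0 * M / Psi).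
have beta0 : 0 <= beta.
  by rewrite addr_ge0// mulr_ge0// divr_ge0// ltW.
have hf u : `|f u - h u| <= D u + Y u.
  rewrite /f /truncate /D /Y; case: ifP => _; first by rewrite addr0 distrC.
  rewrite sub0r normrN addrC -[X in `|X| <= _](subrK (hm u)) addrC.
  exact: ler_normD.
have hb e : `|\int[mu]_u ip (f u) e| <= beta * `|e|.
  have ife : mu.-integrable setT (EFin \o (fun u => ip (f u) e)).
    apply: (@bounded_integrable _ _ _ _ _ (t * `|e|)); first exact: mf.
    by move=> u; apply: (le_trans (ip_CS ipP _ _)); rewrite ler_wpM2r.
  have [ihe he0] := h_centered e.
  rewrite -lee_fin -abse_EFin -EFin_Rintegral//.
  (* As [h] is centered, the mean of [f] is that of [f - h], which has norm at most [D + Y]. *)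
  have -> : (\int[mu]_u (ip (f u) e)%:E = \int[mu]_u (ip (f u - h u) e)%:E)%E.
    under [RHS]eq_integral do rewrite (ipBl ipP) EFinB.
    by rewrite integralB// he0 sube0.
  have mfh : measurable_fun setT (fun u => (ip (f u - h u) e)%:E).
    by apply/measurable_EFinP; apply: (wmeasB ipP).
  apply: (le_trans (le_abse_integral _ _ mfh)) => //.
  apply: (@le_trans _ _ (\int[mu]_u (`|e|%:E * ((D u)%:E + (Y u)%:E)))%E).
    apply: ge0_le_integral => //.
    - exact: measurableT_comp.
    - apply: measurable_funeM; apply: emeasurable_funD; exact/measurable_EFinP.
    - move=> u _; rewrite -EFinD -EFinM lee_fin mulrC.
      by apply: (le_trans (ip_CS ipP _ _)); rewrite ler_wpM2r.
  rewrite ge0_integralZl//; last 2 first.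
  - by apply: emeasurable_funD; exact/measurable_EFinP.
  - by move=> u _; rewrite adde_ge0// lee_fin.
  rewrite ge0_integralD//; [|by move=> u _; rewrite lee_fin|exact/measurable_EFinP|by move=> u _; rewrite lee_fin|exact/measurable_EFinP].
  rewrite (mulrC beta) EFinM; apply: lee_wpmul2l; first by rewrite lee_fin.
  apply: (le_trans (leeD ED EY)); rewrite -EFinD lee_fin /beta; lra.
have hs : \int[mu]_u (`|f u| ^+ 2) <= 5 * (C0 * M) ^+ 2.
  rewrite -lee_fin -EFin_Rintegral//; apply: (le_trans E2); rewrite lee_fin; lra.
have lamw l : lam * m%:R * w l * t <= 1 / 2.
  apply: le_trans lamt; apply: ler_wpM2r; first exact: ltW.
  by apply: ler_wpM2l => //; rewrite mulr_ge0.
(* The coupling part of [beta] uses the class bound by [2 * n * v1], the truncation part only that a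
   class has total weight at most 1. *)
have hd g : (g < m)%N -> m%:R * (\sum_(q < n) w (q * m + g)%N) * beta <= drift.
  move=> gm; have r1 := residue_weight gm.
  have r2 : \sum_(q < n) w (q * m + g)%N <= 1.
    rewrite -w1.
    have : \sum_(l < n) w l = \sum_(l < n * m) w l.
      rewrite -!(big_mkord xpredT w) (@big_cat_nat _ _ _ n 0 (n * m))//=; last by rewrite leq_pmulr.
      rewrite [X in _ = _ + X]big_nat_cond [X in _ = _ + X]big1 ?addr0// => l /andP[/andP[nl _] _].
      exact: wn.
    move=> ->; rewrite (sum_residues w) (bigD1 (Ordinal gm))//= lerDl.
    by apply: sumr_ge0 => ? _; apply: sumr_ge0.
  have c1 : 0 <= 5 * (C0 * delta) by rewrite mulr_ge0.
  have c2' : 0 <= 4 * (C0 * M / Psi) by rewrite mulr_ge0// divr_ge0// ltW.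
  have r2' : m%:R * \sum_(q < n) w (q * m + g)%N <= m%:R by rewrite ler_piMr.
  rewrite /beta mulrDr; apply: (le_trans (lerD (ler_wpM2r c1 r1) (ler_wpM2r c2' r2'))).
  by rewrite le_eqVlt; apply/orP; left; apply/eqP; rewrite driftE; ring.
have Eexp := integral_expR_weighted_sum ipP sV mu_renew m0 mf fm ft beta0 hb hs
  (mulr_ge0 (ler0n _ 5) (sqr_ge0 _)) w0 wn lam0 lamw hd hc2.
pose SD (u : U) := \sum_(l < n) w l * psi (D (seq_drop l u) / delta).
pose SY (u : U) := \sum_(l < n) w l * Y (seq_drop l u).
pose Sf (u : U) := `|\sum_(l < n) w l *: f (seq_drop l u)|.
have msum (g : U -> R) : measurable_fun setT g ->
    measurable_fun setT (fun u : U => \sum_(l < n) w l * g (seq_drop l u)).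
  move=> mg; apply: measurable_sum => l; apply: measurable_funM => //.
  exact: (measurableT_comp mg (measurable_seq_drop l)).
have mSD : measurable_fun setT SD := msum _ mpD.
have mSY : measurable_fun setT SY := msum _ mY.
have mSf : measurable_fun setT Sf.
  apply: (wmeas_norm ipP sV); apply: (wmeas_sum ipP) => l; apply: (wmeasZ ipP) => //.
  exact: (wmeas_comp mf (@measurable_seq_drop _ _ _)).
have SD0 u : 0 <= SD u.
  by apply: sumr_ge0 => l _; rewrite mulr_ge0// psi_norm_ge0.
have SY0 u : 0 <= SY u by apply: sumr_ge0 => l _; rewrite mulr_ge0.
have px := young_gt0 x0.
pose A := [set u | psi x <= SD u].
pose B := [set u | a <= SY u].
pose C := [set u | expR (lam * y) <= expR (lam * Sf u)].
have mset (g : U -> R) c : measurable_fun setT g -> measurable [set u | c <= g u].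
  by move=> mg; rewrite -[X in measurable X]setTI; exact: measurable_fun_le.
have mexp : measurable_fun setT (fun u => expR (lam * Sf u)).
  by apply: (measurableT_comp (@measurable_expR R)); apply: measurable_funM.
have mA : measurable A by exact: mset.
have mB : measurable B by exact: mset.
have mC : measurable C by exact: mset.
have PA : (mu A <= (3 / psi x)%:E)%E.
  apply: (le_trans (markov_real mu mSD SD0 px)).
  rewrite /SD (integral_weighted_drop mpD); last by move=> u; exact: psi_norm_ge0.
  by rewrite mulrC EFinM; apply: lee_wpmul2l; first by rewrite lee_fin invr_ge0 ltW.
have PB : (mu B <= (4 * C0 * M / Psi / a)%:E)%E.
  apply: (le_trans (markov_real mu mSY SY0 a0)).
  rewrite /SY integral_weighted_drop//.
  apply: (@le_trans _ _ ((a^-1)%:E * (C0 * M / Psi * (1 + 3))%:E)%E).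
    by apply: lee_wpmul2l; first by rewrite lee_fin invr_ge0 ltW.
  by rewrite -EFinM lee_fin le_eqVlt; apply/orP; left; apply/eqP; field; rewrite !gt_eqF.
have PC : (mu C <= (2 * expR (lam * drift + 10 * lam ^+ 2 * m%:R ^+ 2 * (C0 * M) ^+ 2 * c2 - lam * y))%:E)%E.
  apply: (le_trans (markov_real mu mexp _ (expR_gt0 _))).
    by move=> u; exact: expR_ge0.
  apply: (le_trans (lee_wpmul2l _ Eexp)); first by rewrite lee_fin invr_ge0 expR_ge0.
  rewrite -EFinM lee_fin -expRN mulrCA -expRD ler_pM2l// ler_expR.
  by rewrite le_eqVlt; apply/orP; left; apply/eqP; ring.
have sub : [set u : U | (2 * x * delta + a + y <= `|\sum_(l < n) w l *: h (seq_drop l u)|)%R]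
    `<=` (A `|` B) `|` C.
  move=> u /= hu; apply: contrapT => /not_orP[/not_orP[/negP nA /negP nB] /negP nC].
  move: nA nB nC; rewrite -!ltNge => nA nB nC; move: hu; apply/negP; rewrite -ltNge.
  have tri : `|\sum_(l < n) w l *: h (seq_drop l u)| <=
      \sum_(l < n) w l * D (seq_drop l u) + SY u + Sf u.
    have -> : \sum_(l < n) w l *: h (seq_drop l u) =
        \sum_(l < n) w l *: (h (seq_drop l u) - f (seq_drop l u)) +
        \sum_(l < n) w l *: f (seq_drop l u).
      by rewrite -big_split/=; apply: eq_bigr => l _; rewrite -scalerDr subrK.
    apply: (le_trans (ler_normD _ _)); rewrite lerD2r.
    apply: (le_trans (ler_norm_sum _ _ _)); rewrite /SY -big_split/=.
    apply: ler_sum => l _; rewrite normrZ (ger0_norm (w0 l)) -mulrDr ler_wpM2l// distrC.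
    exact: hf.
  apply: (le_lt_trans tri).
  (* Outside [A] the average of [psi] is below [psi x], so the two terms of [le_young_ratio]
     contribute at most [x * delta] each. *)
  have bD : \sum_(l < n) w l * D (seq_drop l u) <= 2 * x * delta.
    apply: (@le_trans _ _ (\sum_(l < n) w l * (delta * (x * (1 + psi (D (seq_drop l u) / delta) / psi x))))).
      apply: ler_sum => l _; rewrite ler_wpM2l// -ler_pdivrMl// mulrC.
      by apply: le_young_ratio => //; rewrite divr_ge0// ltW.
    rewrite (_ : \sum_(l < n) _ = delta * x * (\sum_(l < n) w l + SD u / psi x)).
      rewrite w1; have : SD u / psi x <= 1 by rewrite ler_pdivrMr// mul1r ltW.
      move=> h1; rewrite (_ : 2 * x * delta = delta * x * 2); last by ring.
      by apply: ler_wpM2l; [rewrite mulr_ge0// ltW|lra].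
    rewrite /SD mulrDr mulr_suml !mulr_sumr -big_split/=; apply: eq_bigr => l _.
    by field; rewrite gt_eqF.
  have lSf : Sf u < y.
    by move: nC; rewrite ltr_expR; apply: contraTT; rewrite -!leNgt => h1; rewrite ler_wpM2l.
  by rewrite ler_ltD// lerD// ltW.
apply: (le_trans (le_measure mu _ _ sub)); rewrite ?inE.
- by apply: mset; apply: (wmeas_norm ipP sV); apply: (wmeas_sum ipP) => l; apply: (wmeasZ ipP) => //;
    exact: (wmeas_comp mh (@measurable_seq_drop _ _ _)).
- by apply: measurableU => //; exact: measurableU.
apply: (le_trans (measureU2 mu _ _)) => //; first exact: measurableU.
rewrite EFinD; apply: leeD => //.
apply: (le_trans (measureU2 mu _ _)) => //.
by rewrite EFinD; apply: leeD.
Qed.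

End noise_tail.

End young_function.

(** * Product laws on the sequence space are renewable *)

Section product_law.
Context {R : realType} {dS : measure_display} {S : measurableType dS}.
Local Notation U := (seq_space S).
Variable p : set S -> \bar R.

(** Boxes on an initial segment of coordinates suffice: they are closed under intersection and
    generate the sigma-algebra, so they determine the law. *)
Definition product_law d (T : measurableType d) (Q : set T -> \bar R) (f : T -> U) : Prop :=
  forall n (B : nat -> set S), (forall j, measurable (B j)) ->
    Q [set t | forall j, (j < n)%N -> B j (f t j)] = (\prod_(j < n) p (B j))%E.

Let boxes : set (set U) := [set C | exists n (B : nat -> set S),
  (forall j, measurable (B j)) /\ C = [set u : U | forall j, (j < n)%N -> B j (u j)]].

Lemma measurable_box n (B : nat -> set S) d (T : measurableType d) (f : T -> U) :
  (forall j, measurable (B j)) -> measurable_fun setT f ->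
  measurable [set t | forall j, (j < n)%N -> B j (f t j)].
Proof.
move=> mB mf.
rewrite [X in measurable X](_ : _ = \bigcap_(j in [set j | (j < n)%N]) ((fun t => f t j) @^-1` B j)).
  apply: fin_bigcap_measurable => [|j _]; first exact: finite_II.
  rewrite -[X in measurable X]setTI.
  exact: (measurableT_comp (measurable_coord j) mf).
by apply/seteqP; split.
Qed.

Lemma measurable_boxes : @measurable _ U = <<s boxes >>.
Proof.
apply/seteqP; split; apply: smallest_sub; try exact: smallest_sigma_algebra.
  move=> _ [j [A [mA ->]]]; apply: sub_sigma_algebra.
  exists j.+1, (fun i => if i == j then A else setT); split.
    by move=> i; case: ifP.
  apply/seteqP; split => u /=; last by move=> /(_ j (ltnSn _)); rewrite eqxx.
  by move=> Au i _; case: eqP => // ->.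
move=> _ [n [B [mB ->]]].
exact: (measurable_box n mB (@measurable_id _ U setT)).
Qed.

Lemma setI_closed_boxes : setI_closed boxes.
Proof.
move=> _ _ [n [B [mB ->]]] [n' [B' [mB' ->]]].
pose cut k (C : nat -> set S) j := if (j < k)%N then C j else setT.
exists (maxn n n'), (fun j => cut n B j `&` cut n' B' j); split.
  by move=> j; rewrite /cut; apply: measurableI; case: ifP.
apply/seteqP; split => u /=.
  move=> [h h'] j _; rewrite /cut; split.
    by case: ifP => // /h.
  by case: ifP => // /h'.
move=> h; split => j jn.
  by have [|+ _] := h j; [rewrite leq_max jn|rewrite /cut jn].
by have [|_] := h j; [rewrite leq_max jn orbT|rewrite /cut jn].
Qed.

Lemma product_law_unique d1 (T1 : measurableType d1) (Q1 : probability T1 R)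
    d2 (T2 : measurableType d2) (Q2 : probability T2 R)
    (f1 : {mfun T1 >-> U}) (f2 : {mfun T2 >-> U}) :
  product_law Q1 f1 -> product_law Q2 f2 ->
  forall E, measurable E -> distribution Q1 f1 E = distribution Q2 f2 E.
Proof.
move=> h1 h2.
apply: (@measure_unique _ _ _ boxes (fun=> setT)).
- exact: measurable_boxes.
- exact: setI_closed_boxes.
- move=> _; exists 0%N, (fun=> setT); split => //.
  by apply/seteqP; split.
- exact: bigcup_const.
- move=> _ [n [B [mB ->]]].
  by transitivity (\prod_(j < n) p (B j))%E; [exact: h1|exact/esym/h2].
- by move=> _; apply: (@le_lt_trans _ _ 1%E); [exact: probability_le1|exact: ltry].
Qed.

Lemma integral_product_law d1 (T1 : measurableType d1) (Q1 : probability T1 R)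
    d2 (T2 : measurableType d2) (Q2 : probability T2 R)
    (f1 : {mfun T1 >-> U}) (f2 : {mfun T2 >-> U}) :
  product_law Q1 f1 -> product_law Q2 f2 ->
  forall F : U -> \bar R, measurable_fun setT F -> (forall u, 0 <= F u)%E ->
  (\int[Q1]_t F (f1 t) = \int[Q2]_t F (f2 t))%E.
Proof.
move=> h1 h2 F mF F0.
have := @ge0_integral_distribution _ _ _ _ _ Q1 f1 F mF F0.
have := @ge0_integral_distribution _ _ _ _ _ Q2 f2 F mF F0.
rewrite /= => <- <-; apply: eq_measure_integral => E mE _.
exact: product_law_unique.
Qed.

Lemma product_law_distribution d (T : measurableType d) (Q : probability T R)
    (f : {mfun T >-> U}) : product_law Q f -> product_law (distribution Q f) (fun u : U => u).
Proof. by move=> h n B mB; rewrite -h. Qed.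

(** A box for the mixture is a rectangle: the first [minn n m] constraints fall on [u], the
    remaining [n - m] on the start of [u']. *)
Lemma product_law_mix m (mu : probability U R) : product_law mu (fun u : U => u) ->
  product_law (mu \x mu)%E (fun z : U * U => seq_mix m z.1 z.2 : U).
Proof.
move=> h n B mB.
pose C1 := [set u : U | forall j, (j < minn n m)%N -> B j (u j)].
pose C2 := [set u : U | forall j, (j < n - m)%N -> B (m + j)%N (u j)].
rewrite (_ : [set z | _] = C1 `*` C2); last first.
  apply/seteqP; split => [[u u'] /= hz|[u u'] [/= h1 h2] j jn].
    split => /= j jn.
      by have := hz j; rewrite /seq_mix; rewrite leq_min in jn; case/andP: jn => -> -> /(_ isT).
    have <- : seq_mix m u u' (m + j)%N = u' j by rewrite /seq_mix ltnNge leq_addr/= addKn.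
    by apply: hz; lia.
  rewrite /seq_mix; case: ltnP => jm; first by apply: h1; rewrite leq_min jn.
  by have := h2 (j - m)%N; rewrite subnKC//; apply; lia.
rewrite product_measure1E; last 2 first.
- exact: (measurable_box _ mB (@measurable_id _ U setT)).
- exact: (measurable_box _ (fun j => mB (m + j)%N) (@measurable_id _ U setT)).
transitivity ((\prod_(j < minn n m) p (B j)) * (\prod_(j < n - m) p (B (m + j)%N)))%E.
  by congr (_ * _)%E; [exact: h|exact: (h _ (fun j => B (m + j)%N))].
rewrite -!(big_mkord xpredT (fun j => p (B j))) -(big_mkord xpredT (fun j => p (B (m + j)%N))).
have [nm|mn] := leqP n m.
  have -> : (n - m = 0)%N by lia.
  by rewrite [X in (_ * X)%E]big_geq// mule1.
rewrite [RHS](@big_cat_nat _ _ _ m)//=; last exact: ltnW.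
congr (_ * _)%E; rewrite -[in RHS](add0n m) big_addn.
by apply: eq_bigr => j _; rewrite addnC.
Qed.

Lemma product_law_renewable (mu : probability U R) :
  product_law mu (fun u : U => u) -> renewable mu.
Proof.
move=> h m F mF F0.
have mmix : measurable_fun setT (fun z : U * U => seq_mix m z.1 z.2 : U).
  exact: measurable_seq_mix.
pose f1 : {mfun U >-> U} := mfun_Sub (mem_set (@measurable_id _ U setT)).
pose f2 : {mfun (U * U)%type >-> U} := mfun_Sub (mem_set mmix).
have h2 : product_law (mu \x mu)%E f2 by exact: product_law_mix.
have h1 : product_law mu f1 by [].
have := integral_product_law h1 h2 mF F0 => /= ->.
rewrite (@fubini_tonelli2 _ _ _ _ _ mu mu (fun z => F (seq_mix m z.1 z.2)))//.
exact: (measurableT_comp mF mmix).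
Qed.

End product_law.

(** * The law of the past of an i.i.d. family *)

Section iid_law.
Context {R : realType} {d : measure_display} {Omega : measurableType d}.
Variable P : probability Omega R.
Context {dS : measure_display} {S : measurableType dS}.
Local Notation U := (seq_space S).
Variable alpha : int -> Omega -> S.
Hypothesis iid : iid_family P alpha.

Definition past (i : int) (w : Omega) : U := fun j : nat => alpha (i - j%:Z) w.

Lemma measurable_past i : measurable_fun setT (past i).
Proof. by apply: measurable_seqP => j; case: iid => malpha _; exact: malpha. Qed.

Definition past_mfun i : {mfun Omega >-> U} := mfun_Sub (mem_set (measurable_past i)).

Definition marginal (B : set S) : \bar R := P (alpha 0 @^-1` B).

Lemma product_law_past i : product_law marginal P (past i).
Proof.
move=> n B mB; have [_ iidE] := iid.
pose s := [seq i - j%:Z | j <- iota 0 n].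
have us : uniq s.
  by rewrite map_inj_uniq ?iota_uniq// => j j' /eqP; rewrite (inj_eq (addrI _)) eqr_opp => /eqP[].
(* Independence is stated with sets indexed by integers, so the position [j] is recovered from
   [k = i - j] as [|i - k|]. *)
have := iidE s (fun k => B `|(i - k)%R|%N) us (fun k => mB _).
have absE (j : nat) : `|(i - (i - j%:Z))%R|%N = j by lia.
rewrite !big_map => E.
transitivity (P (\big[setI/setT]_(j <- iota 0 n) (alpha (i - j%:Z) @^-1` B j))).
  congr (P _); apply/seteqP; split => w /=.
    move=> h; rewrite -bigcap_seq => j /=; rewrite mem_iota add0n => /andP[_ jn].
    exact: h.
  rewrite -bigcap_seq => h j jn; apply: (h j) => /=.
  by rewrite mem_iota.
have <- : \big[setI/setT]_(j <- iota 0 n) (alpha (i - j%:Z) @^-1` B `|(i - (i - j%:Z))%R|%N) =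
    \big[setI/setT]_(j <- iota 0 n) (alpha (i - j%:Z) @^-1` B j).
  by apply: eq_bigr => j _; rewrite absE.
rewrite E -(big_mkord xpredT (fun j => marginal (B j))) /index_iota subn0.
by apply: eq_bigr => j _; rewrite absE.
Qed.

Definition past_law : probability U R := distribution P (past_mfun 0).

Lemma renewable_past_law : renewable past_law.
Proof.
apply: (@product_law_renewable _ _ _ marginal).
by apply: product_law_distribution; exact: product_law_past.
Qed.

(** The law on the right is free of [i]: this is the stationarity of the noise. *)
Lemma past_lawE i E : measurable E -> P (past i @^-1` E) = past_law E.
Proof.
move=> mE.
exact: (@product_law_unique _ _ _ marginal _ _ P _ _ P (past_mfun i) (past_mfun 0)
  (product_law_past i) (product_law_past 0)).
Qed.

Lemma integral_past i (F : U -> \bar R) : measurable_fun setT F -> (forall u, 0 <= F u)%E ->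
  (\int[P]_w F (past i w) = \int[past_law]_u F u)%E.
Proof.
move=> mF F0; rewrite ge0_integral_distribution//.
exact: (@integral_product_law _ _ _ marginal _ _ P _ _ P (past_mfun i) (past_mfun 0)
  (product_law_past i) (product_law_past 0)).
Qed.

Lemma integral_past_pair i i' (G : U * U -> \bar R) : measurable_fun setT G ->
  (forall z, 0 <= G z)%E ->
  (\int[P \x P]_z G (past i z.1, past i' z.2) =
   \int[past_law]_u' \int[past_law]_u G (u, u'))%E.
Proof.
move=> mG G0.
have mG' : measurable_fun setT (fun z : Omega * Omega => G (past i z.1, past i' z.2)).
  apply: (measurableT_comp mG); apply: measurable_fun_pair.
    exact: (measurableT_comp (measurable_past i)).
  exact: (measurableT_comp (measurable_past i')).
rewrite (@fubini_tonelli2 _ _ _ _ _ P P (fun z => G (past i z.1, past i' z.2)))// /fubini_G/=.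
transitivity (\int[P]_w' (fubini_G past_law G (past i' w')))%E.
  apply: eq_integral => w' _; rewrite /fubini_G.
  apply: (@integral_past i (fun u => G (u, past i' w'))) => //.
  exact: (measurableT_comp mG (measurable_pair2 _)).
apply: (@integral_past i' (fubini_G past_law G)).
  exact: measurable_fun_fubini_tonelli_G.
by move=> u; exact: integral_ge0.
Qed.

Lemma past_law_integral (f : U -> R) : measurable_fun setT f ->
  P.-integrable setT (fun w => (f (past 0 w))%:E) ->
  past_law.-integrable setT (fun u => (f u)%:E) /\
  (\int[past_law]_u (f u)%:E = \int[P]_w (f (past 0 w))%:E)%E.
Proof.
move=> mf fi.
have mfE : measurable_fun setT (fun u => (f u)%:E) by exact/measurable_EFinP.
split; last exact: (@integral_distribution _ _ _ _ _ P (past_mfun 0) (fun u => (f u)%:E)).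
apply/integrableP; split => //.
have /integrableP[_] := fi; apply: le_lt_trans.
by rewrite -(integral_past 0 (F := fun u => `|(f u)%:E|%E))//; exact: measurableT_comp.
Qed.

End iid_law.

(** * Ordering by distance, and the bias *)

Section nearest_neighbours.
Context {R : realType} {F : Type} (dist : F -> F -> R) (X : nat -> F) (x : F).
Variable n : nat.

Let le_nn i j := (dist (X i) x < dist (X j) x) ||
  ((dist (X i) x == dist (X j) x) && (i <= j)%N).
Let s := nn_order dist X x n.

Lemma perm_nn_order : perm_eq s (iota 0 n).
Proof. by rewrite /s /nn_order perm_sort. Qed.

Lemma size_nn_order : size s = n.
Proof. by rewrite (perm_size perm_nn_order) size_iota. Qed.

Lemma sum_nn_order (Z : nmodType) (G : nat -> Z) :
  \sum_(i < n) G i = \sum_(0 <= i < n) G (nth 0%N s i).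
Proof.
rewrite -(big_mkord xpredT G) /index_iota subn0 -(perm_big _ perm_nn_order)/=.
by rewrite (big_nth 0%N) size_nn_order /index_iota subn0.
Qed.

Let le_nn_trans : transitive le_nn.
Proof.
move=> j i k; rewrite /le_nn => /orP[ij|/andP[/eqP ij ij']] /orP[jk|/andP[/eqP jk jk']].
- by rewrite (lt_trans ij jk).
- by rewrite -jk ij.
- by rewrite ij jk.
- by rewrite ij jk eqxx (leq_trans ij' jk') orbT.
Qed.

Let le_nn_total : total le_nn.
Proof.
move=> i j; rewrite /le_nn; case: ltgtP => //= _.
exact: leq_total.
Qed.

Lemma nn_order_sorted i j : (i <= j)%N -> (j < n)%N ->
  dist (X (nth 0%N s i)) x <= dist (X (nth 0%N s j)) x.
Proof.
move=> ij jn; have ss : sorted le_nn s by exact: sort_sorted.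
have refl : reflexive le_nn by move=> k; rewrite /le_nn eqxx leqnn orbT.
have := sorted_leq_nth le_nn_trans refl 0%N ss i j.
rewrite !inE size_nn_order (leq_ltn_trans ij jn) jn => /(_ isT isT ij).
by rewrite /le_nn => /orP[/ltW//|/andP[/eqP-> _]].
Qed.

(** If some admissible [h] were smaller than the distance at rank [i], sortedness would leave at
    most [i < k] points within [h]. *)
Lemma nn_dist_le_radius k i : (i < k)%N -> (k <= n)%N -> (forall z z', 0 <= dist z z') ->
  dist (X (nth 0%N s i)) x <= knn_radius dist X x k n.
Proof.
move=> ik kn d0; apply: lb_le_inf.
  (* The infimum needs a nonempty set; the sum of all distances dominates each of them. *)
  exists (\sum_(j < n) dist (X j) x) => /=.
  rewrite (_ : count _ _ = n)// -[RHS](size_iota 0 n); apply/eqP; rewrite -all_count.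
  apply/allP => j; rewrite mem_iota add0n => /andP[_ jn].
  by rewrite (bigD1 (Ordinal jn))//= lerDl sumr_ge0.
move=> h /= kh; rewrite leNgt; apply/negP => hi.
have : (count (fun j => dist (X j) x <= h)%R s <= i)%N.
  have ins : (i <= size s)%N by rewrite size_nn_order ltnW// (leq_trans ik).
  rewrite -(cat_take_drop i s) count_cat (_ : count _ (drop i s) = 0%N).
    by rewrite addn0 (leq_trans (count_size _ _))// size_takel.
  apply/eqP; rewrite -leqn0 leqNgt -has_count; apply/hasPn => j /(nthP 0%N)[q qs <-].
  rewrite nth_drop -ltNge; apply: lt_le_trans hi _.
  apply: nn_order_sorted; first exact: leq_addr.
  by move: qs; rewrite size_drop size_nn_order; lia.
have /permP -> := perm_nn_order; move=> /(leq_trans kh).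
by rewrite leqNgt ik.
Qed.

End nearest_neighbours.

Lemma knn_bias (R : realType) (F : Type) (dist : F -> F -> R) (V : normedModType R)
    (X : nat -> F) (x : F) (r : F -> V) (W : nat -> nat -> R) (B M0 alpha : R) (k n : nat) :
  semi_metric dist -> (forall i, (i < n)%N -> 0 <= W n i) -> \sum_(i < n) W n i = 1 ->
  0 <= M0 -> 0 <= alpha -> (forall z, `|r z| <= B) ->
  (forall z z', `|r z - r z'| <= M0 * dist z z' `^ alpha) -> (k <= n)%N ->
  `|\sum_(i < n) W n i *: r (X i) - r x| <=
    M0 * knn_radius dist X x k n `^ alpha
    + 2 * B * \sum_(k <= i < n) nn_weight dist X x W n i.
Proof.
move=> [d0 [_ [_ _]]] W0 W1 M00 al0 rB rH kn.
pose s := nn_order dist X x n.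
have snn i : (i < n)%N -> (nth 0%N s i < n)%N.
  move=> i_n; have : nth 0%N s i \in s by rewrite mem_nth// size_nn_order.
  by rewrite (perm_mem (perm_nn_order _ _ _ _)) mem_iota add0n.
have v0 i : (i < n)%N -> 0 <= nn_weight dist X x W n i.
  by move=> i_n; apply: W0; exact: snn.
have E : \sum_(i < n) W n i *: r (X i) - r x =
    \sum_(0 <= i < n) nn_weight dist X x W n i *: (r (X (nth 0%N s i)) - r x).
  rewrite -[X in _ - X]scale1r -W1 scaler_suml -sumrB.
  rewrite (sum_nn_order dist X x n (fun i => W n i *: r (X i) - W n i *: r x)).
  by apply: eq_bigr => i _; rewrite scalerBr.
rewrite {}E (big_cat_nat (n := k))//=; apply: (le_trans (ler_normD _ _)).
have sumv : \sum_(0 <= i < n) nn_weight dist X x W n i = 1.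
  by rewrite -W1 (sum_nn_order dist X x n (W n)).
set H := knn_radius dist X x k n.
apply: lerD.
  apply: (le_trans (ler_norm_sum _ _ _)).
  apply: (@le_trans _ _ (\sum_(0 <= i < k) nn_weight dist X x W n i * (M0 * H `^ alpha))).
    rewrite !big_nat; apply: ler_sum => i /andP[_ ik].
    have i_n := leq_trans ik kn.
    rewrite normrZ (ger0_norm (v0 _ i_n)) ler_wpM2l ?v0//.
    apply: (le_trans (rH _ _)); rewrite ler_wpM2l//.
    have dH := nn_dist_le_radius X x ik kn d0.
    by apply: ge0_ler_powR; rewrite ?nnegrE// (le_trans (d0 _ _) dH).
  rewrite -mulr_suml ler_piMl ?mulr_ge0 ?powR_ge0//.
  rewrite -sumv [leRHS](big_cat_nat (n := k))//= lerDl big_nat sumr_ge0// => i /andP[_].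
  exact: v0.
apply: (le_trans (ler_norm_sum _ _ _)); rewrite mulr_sumr !big_nat.
apply: ler_sum => i /andP[_ i_n]; rewrite normrZ (ger0_norm (v0 _ i_n)) mulrC ler_wpM2r ?v0//.
by apply: (le_trans (ler_normB _ _)); have := rB x; have := rB (X (nth 0%N s i)); lra.
Qed.

(** The bound holds only eventually and [B] has no prescribed sign, so the events are shifted by
    [N0] and summability is read off the boundedness of the partial sums of [B]. *)
Lemma borel_cantelli (R : realType) d (T : measurableType d) (P : probability T R)
    (E : nat -> set T) (B : nat -> R) :
  (forall n, measurable (E n)) -> cvgn (series B) ->
  (\forall n \near \oo, (P (E n) <= (B n)%:E)%E) ->
  {ae P, forall w, \forall n \near \oo, ~ E n w}.
Proof.
move=> mE cB [N0 _ hN].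
pose G n := E (n + N0)%N.
have [M [_ /(_ (M + 1))]] := cvg_seq_bounded cB.
rewrite ltrDl ltr01 => /(_ isT) hM.
have hB n : `|series B n| <= M + 1 by exact: (hM n Logic.I).
have sumG : (\sum_(n <oo) P (G n) < +oo)%E.
  apply: (@le_lt_trans _ _ (2 * (M + 1))%:E); last by rewrite ltry.
  apply: lime_le; first by apply: is_cvg_nneseries => n _ _.
  apply: nearW => n.
  apply: (@le_trans _ _ (\sum_(0 <= i < n) (B (i + N0)%N)%:E)%E).
    by apply: lee_sum => i _; apply: hN => /=; exact: leq_addl.
  rewrite sumEFin lee_fin.
  have -> : \sum_(0 <= i < n) B (i + N0)%N = series B (n + N0)%N - series B N0.
    rewrite /series/= [X in X - _](@big_cat_nat _ _ _ N0)//=; last exact: leq_addl.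
    by have := big_addn 0 (n + N0) N0 xpredT B; rewrite addnK add0n => ->; rewrite addrAC subrr add0r.
  have := hB (n + N0)%N; have := hB N0; rewrite !ler_norml => /andP[? ?] /andP[? ?]; lra.
have mG n : measurable (G n) by exact: mE.
exists (lim_sup_set G); split.
- by apply: bigcapT_measurable => n; apply: bigcup_measurable.
- exact: lim_sup_set_cvg0.
- move=> w /= nw; apply: contrapT => nG; apply: nw.
  move: nG; rewrite /lim_sup_set => /existsNP[n /not_implyP[_ nG]].
  exists (n + N0)%N => // j /= nj Ejw; apply: nG; exists (j - N0)%N => /=; first lia.
  by rewrite /G subnK//; lia.
Qed.

(** * Orlicz norms and admissible scales *)

Section orlicz.
Context {R : realType} (psi : R -> R).
Hypothesis psi0 : psi 0 = 0.
Hypothesis psi_mono : forall s t, 0 <= s -> s <= t -> psi s <= psi t.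

Lemma orlicz_norm_ge0 d (T : measurableType d) (P : set T -> \bar R) (f : T -> R) :
  (0 <= orlicz_norm P psi f)%E.
Proof. by apply/ereal_infP => _ [c [c0 _] <-]; rewrite lee_fin ltW. Qed.

(** The strict inequality yields an admissible scale below [c], so attainment of the infimum is not
    at issue; monotonicity of [psi] passes from that scale to [c]. *)
Lemma orlicz_norm_lt d (T : measurableType d) (P : {measure set T -> \bar R}) (f : T -> R) (c : R) :
  measurable_fun setT f -> (forall u, 0 <= f u) ->
  (orlicz_norm P psi f < c%:E -> \int[P]_u (psi (f u / c))%:E <= 1)%E.
Proof.
move=> mf f0 /ereal_inf_lt[_ [c' [c'0 h] <-]]; rewrite lte_fin => c'c.
have c0 : 0 < c by apply: lt_trans c'c.
have mpsi b : 0 < b -> measurable_fun setT (fun u => (psi (f u / b))%:E).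
  move=> b0; apply/measurable_EFinP; apply: measurable_young => //.
    by apply: measurable_funM.
  by move=> u; rewrite divr_ge0// ltW.
apply: le_trans h; apply: ge0_le_integral => //.
- by move=> u _; rewrite lee_fin young_ge0// divr_ge0// ltW.
- exact: mpsi.
- exact: mpsi.
- move=> u _; rewrite lee_fin; apply: psi_mono; first by rewrite divr_ge0// ltW.
  by rewrite ler_wpM2l// lef_pV2 ?posrE// ltW.
Qed.

End orlicz.

Section scale_choice.
Context {R : realType}.
Variables (psi phi : R -> R) (C0 rr : R).
Hypothesis psi0 : psi 0 = 0.
Hypothesis psi_mono : forall s t, 0 <= s -> s <= t -> psi s <= psi t.
Hypothesis C00 : 0 < C0.
Hypothesis rr2 : 2 <= rr.
Hypothesis phi0 : phi 0 = 0.
Hypothesis phi1 : phi 1 = 1.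
Hypothesis phi_mono : forall s t, 0 <= s -> s <= t -> phi s <= phi t.
Hypothesis phi_concave : forall s t l, 0 <= s -> 0 <= t -> 0 <= l -> l <= 1 ->
  l * phi s + (1 - l) * phi t <= phi (l * s + (1 - l) * t).
Hypothesis growth : forall t, 0 <= t -> t `^ rr <= phi (psi (C0 * t)).

Let pos t : 0 < t -> 0 < psi t.
Proof. by move=> t0; exact: (young_gt0 psi0 psi_mono C00 phi0 growth). Qed.

Let unb A : exists2 x : R, 0 < x & A <= psi x.
Proof. exact: (young_unbounded psi0 psi_mono C00 rr2 phi0 phi1 phi_mono phi_concave growth). Qed.

(* When [g = 0] the quotient [a / (2 * N * g)] is the junk value [0] and carries
   no information; a small enough scale is then chosen directly. *)
Lemma coupling_scale (a g N C e : R) : 0 < a -> 0 <= g -> 1 <= N -> 0 <= C -> 0 < e ->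
  1 / psi (a / (2 * N * g)) < 1 / psi 1 ->
  exists del, [/\ 0 < del, C * g < del,
    1 / psi ((C + 1) * a / del) <= 1 / psi (a / (2 * N * g)) + e
    & N * del <= (C + 1) * a].
Proof.
move=> a0 g0 N1 CC e0 h4.
have N0 : 0 < N by apply: lt_le_trans N1.
have C1 : 0 < C + 1 by lra.
have Ca : 0 < (C + 1) * a by rewrite mulr_gt0.
have p1 := pos (@ltr01 R).
have [g00|gn] := eqVneq g 0.
  have [x x0 hx] := unb (1 / e).
  (* The summand [x] makes [psi y] at least [1 / e]; the summand [N] gives the last inequality. *)
  pose y := x + N; have y0 : 0 < y by rewrite /y; lra.
  exists ((C + 1) * a / y); split.
  - by rewrite divr_gt0.
  - by rewrite g00 mulr0 divr_gt0.
  - have -> : (C + 1) * a / ((C + 1) * a / y) = y by field; rewrite !gt_eqF.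
    rewrite g00 mulr0 invr0 mulr0 psi0 invr0 mulr0 add0r div1r invf_ple ?posrE//; last exact: pos.
    by rewrite -div1r (le_trans hx)//; apply: psi_mono; [exact: ltW|rewrite /y; lra].
  - by rewrite mulrA ler_pdivrMr// mulrC ler_pM2l// /y; lra.
have gp : 0 < g by rewrite lt_neqAle eq_sym gn.
have D0 : 0 < 2 * N * g by rewrite !mulr_gt0.
(* The threshold [1 / psi 1] forces the argument of [psi] to be at least 1, that is
   [2 * N * g <= a]. *)
have q1 : 1 <= a / (2 * N * g).
  rewrite leNgt; apply/negP => q1; move: h4; apply/negP; rewrite -leNgt.
  have qp : 0 < a / (2 * N * g) by rewrite divr_gt0.
  rewrite ler_pM2l// lef_pV2 ?posrE ?pos//; apply: psi_mono; exact: ltW.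
exists ((C + 1) * g); split.
- by rewrite mulr_gt0.
- by rewrite ltr_pM2r//; lra.
- have -> : (C + 1) * a / ((C + 1) * g) = a / g by field; rewrite !gt_eqF.
  apply: (@le_trans _ _ (1 / psi (a / (2 * N * g)))); last by rewrite lerDl ltW.
  rewrite ler_pM2l// lef_pV2 ?posrE ?pos ?divr_gt0//; apply: psi_mono; first by rewrite ltW// divr_gt0.
  rewrite ler_pM2l// lef_pV2 ?posrE// ler_peMl// ?ltW//; lra.
- move: q1; rewrite ler_pdivlMr// mul1r => q1.
  rewrite mulrCA ler_pM2l// (le_trans _ q1)// -mulrA ler_peMl// ?mulr_ge0 ?ltW//; lra.
Qed.

(** The factor 2 beside [M] in the third series leaves room for a scale strictly above [M]. When
    [M = 0] the quotient on the right is 0 by convention and a small scale is chosen by hand. *)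
Lemma truncation_scale (M T q e : R) : 0 <= M -> 0 < T -> 0 < q -> 0 < e ->
  exists M', [/\ M < M', M' <= 2 * M + 1 &
    q / psi (T / M') `^ (1 - rr^-1) <= q / psi (T / (2 * M)) `^ (1 - rr^-1) + e].
Proof.
move=> M0 T0 q0 e0.
have rr0 : 0 < rr by apply: lt_le_trans rr2.
have rh : 2^-1 <= 1 - rr^-1.
  have : rr^-1 <= 2^-1 by rewrite lef_pV2 ?posrE.
  lra.
have [M00|Mn] := eqVneq M 0; last first.
  have Mp : 0 < M by rewrite lt_neqAle eq_sym Mn.
  by exists (2 * M); split; [lra|lra|rewrite lerDl ltW].
(* Since [1 - rr^-1] is at least 1/2, it suffices that [psi y] exceeds [(q / e) ^+ 2]; adding [T] to
   [x] keeps [M'] at most 1. *)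
have [x x0 hx] := unb (1 + (q / e) ^+ 2).
pose y := x + T; have y0 : 0 < y by rewrite /y; lra.
exists (T / y); rewrite M00 mulr0; split; first by rewrite divr_gt0.
  by rewrite add0r ler_pdivrMr// mul1r /y; lra.
have -> : T / (T / y) = y by field; rewrite !gt_eqF.
have hy : 1 + (q / e) ^+ 2 <= psi y by apply: (le_trans hx); apply: psi_mono; [exact: ltW|rewrite /y; lra].
have qe0 : 0 <= q / e by rewrite divr_ge0// ltW.
have py1 : 1 <= psi y by apply: le_trans hy; rewrite lerDl sqr_ge0.
have pq : q / e <= psi y `^ (1 - rr^-1).
  apply: (@le_trans _ _ (psi y `^ 2^-1)); last by rewrite ler_powR.
  rewrite powR12_sqrt; last by apply: le_trans py1.
  rewrite -(ger0_norm qe0) -sqrtr_sqr ler_wsqrtr// (le_trans _ hy)//; lra.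
have pp : 0 < psi y `^ (1 - rr^-1) by rewrite powR_gt0// (lt_le_trans _ py1).
apply: (@le_trans _ _ e); last by rewrite lerDr divr_ge0 ?powR_ge0// ltW.
by rewrite ler_pdivrMr// mulrC -ler_pdivrMr.
Qed.

End scale_choice.

(** * Weights reindexed by time lag *)

Section nn_weights.
Context {R : realType} {F : Type} (dist : F -> F -> R) (X : nat -> F) (x : F).
Variables (W : nat -> nat -> R) (n : nat).
Hypothesis n0 : (0 < n)%N.
Hypothesis W0 : forall i, (i < n)%N -> 0 <= W n i.
Hypothesis W1 : \sum_(i < n) W n i = 1.
Hypothesis Wmono : forall i j, (i <= j)%N -> (j < n)%N ->
  nn_weight dist X x W n j <= nn_weight dist X x W n i.

Lemma weight_le_first i : (i < n)%N -> W n i <= nn_weight dist X x W n 0.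
Proof.
move=> i_n.
have : i \in nn_order dist X x n.
  by rewrite (perm_mem (perm_nn_order _ _ _ _)) mem_iota.
move=> /(nthP 0%N)[q]; rewrite size_nn_order => qn <-.
exact: Wmono.
Qed.

Lemma first_weight_ge : 1 <= n%:R * nn_weight dist X x W n 0.
Proof.
have : \sum_(i < n) W n i <= \sum_(i < n) nn_weight dist X x W n 0.
  by apply: ler_sum => i _; exact: weight_le_first.
by rewrite W1 sumr_const card_ord mulr_natl.
Qed.

(** Indexing by the distance to the last observation matches the shifts of a single past sequence;
    the extension by 0 absorbs the surplus indices of the residue classes. *)
Definition lag_weight (l : nat) : R := if (l < n)%N then W n (n.-1 - l)%N else 0.

Lemma sum_lag (Z : nmodType) (G : nat -> R -> Z) :
  \sum_(l < n) G l (lag_weight l) = \sum_(i < n) G (n.-1 - i)%N (W n i).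
Proof.
rewrite (reindex_inj rev_ord_inj)/=; apply: eq_bigr => i _.
have i_n := ltn_ord i; rewrite /lag_weight.
have -> : (n - i.+1 < n)%N by lia.
by congr (G _ (W n _)); lia.
Qed.

Lemma lag_weight_ge0 l : 0 <= lag_weight l.
Proof. by rewrite /lag_weight; case: ifP => // ln; apply: W0; lia. Qed.

Lemma lag_weight_le l : lag_weight l <= nn_weight dist X x W n 0.
Proof.
rewrite /lag_weight; case: ifP => ln; first by apply: weight_le_first; lia.
by apply: le_trans (weight_le_first n0); exact: W0.
Qed.

Lemma sum_lag_weight_sqr :
  \sum_(l < n) lag_weight l ^+ 2 = \sum_(i < n) nn_weight dist X x W n i ^+ 2.
Proof.
rewrite (sum_lag (fun _ v => v ^+ 2)) (sum_nn_order dist X x n (fun i => W n i ^+ 2)).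
by rewrite big_mkord.
Qed.

End nn_weights.

Lemma seq_drop_past d (Omega : measurableType d) dS (S : measurableType dS)
    (al : int -> Omega -> S) (i n : nat) (w : Omega) : (i < n)%N ->
  seq_drop (n.-1 - i) (past al n.-1%:Z w) = past al i%:Z w.
Proof.
by move=> i_n; apply/funext => j; rewrite /seq_drop /past; congr (al _ w); lia.
Qed.

(** * Almost sure bound for the noise *)

Section noise.
Context {R : realType} {F : Type} {dist : F -> F -> R} {V : normedModType R} {ip : V -> V -> R}
  {d : measure_display} {Omega : measurableType d} {P : probability Omega R}
  {X : nat -> F} {x : F} {eps : nat -> Omega -> V} {W : nat -> nat -> R} {c2 : nat -> R}
  {psi phi : R -> R} {C0 rr M : R} {gamma : nat -> R} {a L xs : nat -> R} {m : nat -> nat}.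
Hypothesis ipP : is_inner_product ip.
Hypothesis sV : separable_space V.
Hypothesis centered : forall (i : nat) (e : V),
  P.-integrable setT (fun w => (ip (eps i w) e)%:E) /\ (\int[P]_w (ip (eps i w) e)%:E = 0)%E.
Hypothesis W0 : forall n i, (i < n)%N -> 0 <= W n i.
Hypothesis W1 : forall n, (0 < n)%N -> \sum_(i < n) W n i = 1.
Hypothesis Wmono : forall n i j, (i <= j)%N -> (j < n)%N ->
  nn_weight dist X x W n j <= nn_weight dist X x W n i.
Hypothesis sqr_bound : exists C : R, \forall n \near \oo,
  Num.sqrt (\sum_(i < n) nn_weight dist X x W n i ^+ 2) <= C * `|c2 n|.
Hypothesis psi0 : psi 0 = 0.
Hypothesis psi_mono : forall s t, 0 <= s -> s <= t -> psi s <= psi t.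
Hypothesis psi_convex : forall s t l, 0 <= s -> 0 <= t -> 0 <= l -> l <= 1 ->
  psi (l * s + (1 - l) * t) <= l * psi s + (1 - l) * psi t.
Hypothesis C00 : 0 < C0.
Hypothesis rr2 : 2 <= rr.
Hypothesis phi0 : phi 0 = 0.
Hypothesis phi1 : phi 1 = 1.
Hypothesis phi_mono : forall s t, 0 <= s -> s <= t -> phi s <= phi t.
Hypothesis phi_concave : forall s t l, 0 <= s -> 0 <= t -> 0 <= l -> l <= 1 ->
  l * phi s + (1 - l) * phi t <= phi (l * s + (1 - l) * t).
Hypothesis growth : forall t, 0 <= t -> t `^ rr <= phi (psi (C0 * t)).
Hypothesis normM : forall i, orlicz_norm P psi (fun w => `|eps i w|) = M%:E.
Hypothesis gamma0 : forall j, 0 <= gamma j.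
Hypothesis approx : psi_m_approx ip P psi eps gamma.
Hypothesis a0 : forall n, 0 < a n.
Hypothesis L0 : forall n, 0 < L n.
Hypothesis xs0 : forall n, 0 < xs n.
Hypothesis mP : forall n, (0 < n)%N -> (1 <= m n)%N /\ (m n <= n)%N.

Let v1 n := nn_weight dist X x W n 0%N.
Let den n := a n * L n + (m n)%:R ^+ 2 * c2 n ^+ 2 + xs n.
Let term3 n := ((m n)%:R / a n) / (psi (L n / (2 * M * (m n)%:R * v1 n))) `^ (1 - rr^-1).
Let term4 n := 1 / psi (a n / (2 * n%:R * v1 n * gamma (m n))).

Let M0 : 0 <= M.
Proof. by rewrite -lee_fin -(normM 0%N) orlicz_norm_ge0. Qed.

(* The constants are uniform in [n]; [e] is a free summable slack. *)
Lemma noise_event_bound (C1 : R) : 0 < C1 -> exists K kap : R, [/\ 0 <= K, 0 <= kap &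
  \forall n \near \oo, forall e : R, 0 < e -> term3 n + e <= 1 -> term4 n < 1 / psi 1 ->
  (P [set w | (K * a n <= `|\sum_(i < n) W n i *: eps i w|)%R] <=
   (3 * (term4 n + e) + kap * (term3 n + e) + 2 * expR (- (C1 * a n ^+ 2) / den n))%:E)%E].
Proof.
move=> C10.
have [dS [S [al [h [iid [mh [epsE [_ [_ [C hC]]]]]]]]]] := approx.
have [Cc hCc] := sqr_bound.
pose U := seq_space S.
have mhw : weakly_measurable ip (h : U -> V).
  by move=> e _ B mB; rewrite setTI; exact: mh.
pose mu := past_law iid.
have mu_renew : renewable mu := renewable_past_law iid.
have epsP i w : eps i w = h (past al i w) by rewrite epsE.
have mnh : measurable_fun setT (fun u : U => `|h u|) := wmeas_norm ipP sV mhw.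
have mpast i : measurable_fun setT (past al i : Omega -> U) := measurable_past iid i.
have hcent e : mu.-integrable setT (fun u => (ip (h u) e)%:E) /\
    (\int[mu]_u (ip (h u) e)%:E = 0)%E.
  have [ie ze] := centered 0%N e.
  have ie' : P.-integrable setT (fun w => (ip (h (past al 0 w)) e)%:E).
    by move: ie; under eq_fun do rewrite epsP.
  have [i1 i2] := past_law_integral iid (mhw e) ie'.
  split => //; rewrite i2 -[RHS]ze.
  by apply: eq_integral => w _; rewrite epsP.
pose Cg := `|C|.
(* [K0] bounds the scale [M']; [kd] and [ks] are the costs of drift and variance in units of
   [lam * a n]. [Ky] adds [2 * C1], which leaves exactly [- C1 * a n ^+ 2 / den n] in the exponent.
   [K] collects the three allowances, with [x] taken as [(Cg + 1) * a n / del]. *)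
pose K0 := 2 * M + 1.
pose kd := 10 * C0 * (Cg + 1) + 4 * C0 * K0.
pose ks := 10 * (C0 * K0) ^+ 2 * Cc ^+ 2.
pose Ky := kd + ks + 2 * C1.
pose K := 2 * (Cg + 1) + 1 + Ky.
have K00 : 0 < K0 by rewrite /K0; have := M0; lra.
have Cg0 : 0 <= Cg by exact: normr_ge0.
have C0ge := ltW C00; have K0ge := ltW K00.
have kd0 : 0 <= kd by rewrite /kd addr_ge0// !mulr_ge0// addr_ge0.
have ks0 : 0 <= ks by exact: mulr_ge0 (mulr_ge0 (ler0n _ _) (sqr_ge0 _)) (sqr_ge0 _).
have Ky0 : 0 <= Ky by apply: addr_ge0; [exact: addr_ge0|rewrite mulr_ge0// ltW].
exists K, (4 * C0 * K0); split.
- by rewrite /K addr_ge0// addr_ge0// mulr_ge0// addr_ge0.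
- by rewrite !mulr_ge0// ltW.
near=> n => e e0 h3 h4.
have n0 : (0 < n)%N by near: n; exact: nbhs_infty_gt.
have hc : Num.sqrt (\sum_(i < n) nn_weight dist X x W n i ^+ 2) <= Cc * `|c2 n| by near: n.
have [m1 mn] := mP n0.
have mR : (1 : R) <= (m n)%:R by rewrite ler1n.
have mR0 : (0 : R) < (m n)%:R by rewrite ltr0n.
have N1 : 1 <= n%:R * v1 n by exact: (first_weight_ge (@W1 n n0) (@Wmono n)).
have nR : (0 : R) < n%:R by rewrite ltr0n.
have v10 : 0 < v1 n.
  by rewrite -(pmulr_rgt0 _ nR); apply: lt_le_trans N1.
have NE : 2 * (n%:R * v1 n) * gamma (m n) = 2 * n%:R * v1 n * gamma (m n) by ring.
have h4' : 1 / psi (a n / (2 * (n%:R * v1 n) * gamma (m n))) < 1 / psi 1 by rewrite NE.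
have [del [del0 Cdel hdel Ndel]] := coupling_scale psi0 psi_mono C00 rr2 phi0 phi1 phi_mono
  phi_concave growth (a0 n) (gamma0 (m n)) N1 Cg0 e0 h4'.
have T0 : 0 < L n / ((m n)%:R * v1 n) by rewrite divr_gt0// mulr_gt0.
have q0 : 0 < (m n)%:R / a n by rewrite divr_gt0.
have [M' [MM' M'K hM']] := truncation_scale psi0 psi_mono C00 rr2 phi0 phi1 phi_mono
  phi_concave growth M0 T0 q0 e0.
have M'0 : 0 < M' by apply: le_lt_trans MM'.
set T := L n / ((m n)%:R * v1 n) in T0 hM'.
have TE : T / (2 * M) = L n / (2 * M * (m n)%:R * v1 n).
  by rewrite /T -mulrA -invfM; congr (_ / _); ring.
rewrite TE -/(term3 n) in hM'.
rewrite NE -/(term4 n) in hdel.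
have HM : (\int[mu]_u (psi (`|h u| / M'))%:E <= 1)%E.
  rewrite -(integral_past iid 0)//; last 2 first.
  - apply/measurable_EFinP; apply: measurable_young => //; first by apply: measurable_funM.
    by move=> u; rewrite divr_ge0// ltW.
  - by move=> u; rewrite lee_fin young_ge0// divr_ge0// ltW.
  apply: (@orlicz_norm_lt _ psi psi0 psi_mono _ _ P (fun w => `|h (past al 0 w)|)).
  - exact: (measurableT_comp mnh (mpast 0)).
  - by move=> w; exact: normr_ge0.
  - have -> : (fun w => `|h (past al 0 w)|) = (fun w => `|eps 0%N w|).
      by apply/funext => w; rewrite epsP.
    by rewrite normM lte_fin.
have Hdelta : (\int[mu]_u' \int[mu]_u (psi (`|h u - h (seq_mix (m n) u u')| / del))%:E <= 1)%E.
  pose f0 (z : U * U) := `|h z.1 - h (seq_mix (m n) z.1 z.2)|.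
  have f00 z : 0 <= f0 z by exact: normr_ge0.
  have mf0 : measurable_fun setT f0.
    apply: (wmeas_norm ipP sV); apply: (wmeasB ipP); first exact: (wmeas_comp mhw measurable_fst).
    by apply: (wmeas_comp mhw); apply: measurable_seq_mix.
  pose G (z : U * U) := (psi (f0 z / del))%:E.
  have mG : measurable_fun setT G.
    apply/measurable_EFinP; apply: measurable_young => //; first by apply: measurable_funM.
    by move=> u; rewrite divr_ge0// ltW.
  have G0 z : (0 <= G z)%E by rewrite lee_fin young_ge0// divr_ge0// ltW.
  rewrite -(integral_past_pair iid (m n)%:Z 0 mG G0).
  (* At time [m n] the coupled tail reads [alpha'] at [m n - j] for [j >= m n], which is the past of
     the second factor at time 0. *)
  pose f1 (z : Omega * Omega) := f0 (past al (m n)%:Z z.1, past al 0 z.2).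
  have mf1 : measurable_fun setT f1.
    apply: (measurableT_comp mf0); apply: measurable_fun_pair.
      exact: (measurableT_comp (mpast _)).
    exact: (measurableT_comp (mpast _)).
  apply: (@orlicz_norm_lt _ psi psi0 psi_mono _ _ (P \x P)%E f1) => //.
    by move=> z; exact: normr_ge0.
  apply: (@le_lt_trans _ _ (C * gamma (m n))%:E); last first.
    rewrite lte_fin; apply: le_lt_trans Cdel; rewrite ler_wpM2r//; exact: ler_norm.
  apply: le_trans (hC (m n) m1).
  (* The decay rate bounds a tail sum; its first term is the one wanted. *)
  set D := (X in (_ <= \sum_(_ <= j <oo) X j)%E).
  have D0 j : (0 <= D j)%E by exact: orlicz_norm_ge0.
  have := @nneseries_lim_ge R D xpredT (m n) (m n).+1 (fun j _ _ => D0 j).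
  rewrite big_nat1; apply: le_trans.
  rewrite le_eqVlt; apply/orP; left; apply/eqP; rewrite /D; congr (orlicz_norm _ _ _).
  apply/funext => z; rewrite /f1 /f0/=; congr (`|_ - h _|); apply/funext => j.
  rewrite /seq_mix /past; case: ltnP => // jm; congr (al _ _).
  by rewrite sub0r -[in RHS]opprB subzn.
(* The summand [a n * L n] of [den] keeps the step below 1/2, and the summand with [c2] makes the
   variance cost linear in [lam * a n]. *)
pose lam := a n / (2 * den n).
have den0 : 0 < den n.
  rewrite /den ltr_wpDl// addr_ge0//; first by rewrite mulr_ge0// ltW.
  by rewrite mulr_ge0// sqr_ge0.
have lam0 : 0 <= lam by rewrite divr_ge0 ?mulr_ge0// ltW.
have lamt : lam * (m n)%:R * v1 n * T <= 1 / 2.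
  have -> : lam * (m n)%:R * v1 n * T = (a n * L n) / den n / 2.
    by rewrite /lam /T; field; rewrite !gt_eqF.
  rewrite ler_pM2r ?invr_gt0// ler_pdivrMr// mul1r /den -addrA lerDl.
  by apply: addr_ge0; [rewrite mulr_ge0// sqr_ge0|exact: ltW].
have Cc2 : \sum_(l < n) lag_weight W n l ^+ 2 <= Cc ^+ 2 * c2 n ^+ 2.
  rewrite (sum_lag_weight_sqr dist X x W n0) -[X in _ * X]real_normK ?num_real// -exprMn.
  have s0 : 0 <= \sum_(i < n) nn_weight dist X x W n i ^+ 2.
    by apply: sumr_ge0 => i _; exact: sqr_ge0.
  rewrite -[leLHS](sqr_sqrtr s0) lerXn2r// nnegrE ?sqrtr_ge0//.
  exact: le_trans (sqrtr_ge0 _) hc.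
have xx0 : 0 < (Cg + 1) * a n / del by rewrite divr_gt0// mulr_gt0// ltr_wpDl.
have lw1 : \sum_(l < n) lag_weight W n l = 1.
  by rewrite (sum_lag W n0 (fun _ v => v)) W1.
have lwn l : (n <= l)%N -> lag_weight W n l = 0 by rewrite /lag_weight ltnNge => ->.
have := noise_tail psi0 psi_mono psi_convex C00 rr2 phi0 phi1 phi_mono phi_concave growth
  ipP sV mu_renew mhw hcent m1 mn (lag_weight_ge0 n0 (@W0 n)) lwn lw1
  (lag_weight_le n0 (@W0 n) (@Wmono n)) del0 M'0 T0 Hdelta HM
  (Ky * a n) (a0 n) xx0 lam0 lamt Cc2 erefl erefl.
set Psi := psi (T / M') `^ (1 - rr^-1) in hM' *.
set drift := (X in lam * X + _).
have -> : 2 * ((Cg + 1) * a n / del) * del + a n + Ky * a n = K * a n.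
  by rewrite /K; field; rewrite gt_eqF.
set E := (X in mu X).
move=> tail.
have mE : measurable E.
  rewrite -[X in measurable X]setTI; apply: measurable_fun_le => //.
  apply: (wmeas_norm ipP sV); apply: (wmeas_sum ipP) => l; apply: (wmeasZ ipP) => //.
  exact: (wmeas_comp mhw (@measurable_seq_drop _ _ _)).
have sumE w : \sum_(i < n) W n i *: eps i w =
    \sum_(l < n) lag_weight W n l *: h (seq_drop l (past al n.-1%:Z w)).
  rewrite (sum_lag W n0 (fun l v => v *: h (seq_drop l (past al n.-1%:Z w)))).
  by apply: eq_bigr => i _; rewrite epsP seq_drop_past.
have -> : [set w | (K * a n <= `|\sum_(i < n) W n i *: eps i w|)%R] = past al n.-1%:Z @^-1` E.
  by apply/seteqP; split => w; rewrite /E /preimage/= sumE.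
rewrite (past_lawE iid)//; apply: (le_trans tail).
have Psi0 : 0 < Psi.
  by rewrite powR_gt0//; apply: (young_gt0 psi0 psi_mono C00 phi0 growth); rewrite divr_gt0.
have q1 : (m n)%:R / a n / Psi <= 1 by apply: le_trans h3.
(* A third-series term below 1 makes the drift caused by truncation of order [a n]. *)
have mPsi : (m n)%:R / Psi <= a n.
  by move: q1; rewrite mulrAC ler_pdivrMr// mul1r.
have an0 := ltW (a0 n).
rewrite lee_fin; apply: lerD; first apply: lerD.
- by move: hdel; rewrite div1r => hdel; rewrite ler_pM2l.
- apply: (@le_trans _ _ (4 * C0 * K0 * ((m n)%:R / a n / Psi))); last first.
    by apply: ler_wpM2l => //; rewrite !mulr_ge0.
  have -> : 4 * C0 * M' / Psi / a n = 4 * C0 * M' * (1 / a n / Psi) by field; rewrite !gt_eqF.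
  apply: ler_pM.
  + by rewrite !mulr_ge0// ltW.
  + by rewrite !divr_ge0// ltW.
  + by apply: ler_wpM2l => //; rewrite mulr_ge0.
  + by rewrite ler_pM2r ?invr_gt0// ler_pM2r ?invr_gt0.
rewrite ler_pM2l// ler_expR.
have la0 : 0 <= lam * a n by rewrite mulr_ge0.
have hdrift : lam * drift <= kd * (lam * a n).
  rewrite mulrCA ler_wpM2l// /drift /kd (mulrDl (10 * C0 * (Cg + 1)) (4 * C0 * K0)); apply: lerD.
    have -> : 10 * (n%:R * v1 n) * (C0 * del) = 10 * C0 * (n%:R * v1 n * del) by ring.
    by rewrite -(mulrA (10 * C0)) ler_wpM2l// mulr_ge0.
  have -> : 4 * (m n)%:R * (C0 * M' / Psi) = 4 * C0 * M' * ((m n)%:R / Psi) by field; rewrite gt_eqF.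
  apply: ler_pM => //.
  + by rewrite !mulr_ge0// ltW.
  + by rewrite divr_ge0// ltW.
  + by apply: ler_wpM2l => //; rewrite mulr_ge0.
have hs : 10 * lam ^+ 2 * (m n)%:R ^+ 2 * (C0 * M') ^+ 2 * (Cc ^+ 2 * c2 n ^+ 2) <=
    ks * (lam * a n).
  have -> : 10 * lam ^+ 2 * (m n)%:R ^+ 2 * (C0 * M') ^+ 2 * (Cc ^+ 2 * c2 n ^+ 2) =
     10 * (C0 * M') ^+ 2 * Cc ^+ 2 * (lam * (lam * ((m n)%:R ^+ 2 * c2 n ^+ 2))) by ring.
  have mc0 : 0 <= (m n)%:R ^+ 2 * c2 n ^+ 2 by rewrite mulr_ge0// sqr_ge0.
  apply: ler_pM.
  + exact: mulr_ge0 (mulr_ge0 (ler0n _ _) (sqr_ge0 _)) (sqr_ge0 _).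
  + by rewrite !(mulr_ge0 lam0).
  + apply: ler_wpM2r; first exact: sqr_ge0.
    apply: ler_wpM2l => //; rewrite lerXn2r ?nnegrE ?mulr_ge0// ?(ltW M'0)//.
    exact: ler_wpM2l.
  + apply: ler_wpM2l => //; rewrite /lam mulrAC ler_pdivrMr ?mulr_gt0//.
    apply: ler_wpM2l => //; apply: (@le_trans _ _ (den n)); last by lra.
    rewrite /den -addrA addrCA lerDl addr_ge0// ?mulr_ge0// ltW//.
have -> : - (C1 * a n ^+ 2) / den n = (kd + ks - Ky) * (lam * a n).
  by rewrite /Ky /lam; field; rewrite gt_eqF.
rewrite mulrBl (mulrDl kd ks) (_ : lam * (Ky * a n) = Ky * (lam * a n)); last by ring.
by rewrite lerD2r lerD.
Unshelve. all: by end_near. Qed.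

Lemma noise_ae :
  (exists C : R, 0 < C /\ cvgn (series (fun n => expR (- (C * a n ^+ 2) / den n)))) ->
  cvgn (series term3) -> cvgn (series term4) ->
  exists2 K, 0 <= K & {ae P, forall w, \forall n \near \oo,
    `|\sum_(i < n) W n i *: eps i w| <= K * a n}.
Proof.
move=> [C1 [C10 cv1]] cv3 cv4.
have [K [kap [K0 kap0 hn]]] := noise_event_bound C10.
exists K => //.
(* The slack has to be positive and summable. *)
pose e n : R := geometric 1 2^-1 n.
have e0 n : 0 < e n by rewrite /e/= mul1r exprn_gt0.
have cve : cvgn (series e).
  by apply: is_cvg_geometric_series; rewrite ger0_norm//; lra.
pose B n := 3 * (term4 n + e n) + kap * (term3 n + e n) + 2 * expR (- (C1 * a n ^+ 2) / den n).
have cvB : cvgn (series B).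
  have -> : series B = 3 *: (series term4 + series e) + kap *: (series term3 + series e)
      + 2 *: series (fun n => expR (- (C1 * a n ^+ 2) / den n)).
    apply/funext => n; rewrite /series/= !fctE/= -!big_split/= !scaler_sumr -!big_split/=.
    by apply: eq_bigr.
  apply: is_cvgD; last exact: is_cvgZr.
  by apply: is_cvgD; apply: is_cvgZr; exact: is_cvgD.
(* Terms of convergent series tend to 0, so the two smallness conditions of the event bound hold
   eventually. *)
have lim3 : term3 \+ e @ \oo --> 0 + 0 by apply: cvgD; exact: cvg_series_cvg_0.
have lim4 : term4 @ \oo --> 0 by exact: cvg_series_cvg_0.
have psi1 : 0 < 1 / psi 1.
  by rewrite divr_gt0//; apply: (young_gt0 psi0 psi_mono C00 phi0 growth).
pose E n := [set w | (K * a n <= `|\sum_(i < n) W n i *: eps i w|)%R].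
have mE n : measurable (E n).
  have [dS [S [al [h [iid [mh [epsE _]]]]]]] := approx.
  rewrite -[X in measurable X]setTI; apply: measurable_fun_le => //.
  apply: (wmeas_norm ipP sV); apply: (wmeas_sum ipP) => i; apply: (wmeasZ ipP) => //.
  move=> e1; rewrite epsE.
  have mhw : weakly_measurable ip (h : seq_space S -> V).
    by move=> e2 _ B' mB'; rewrite setTI; exact: mh.
  exact: (wmeas_comp mhw (measurable_past iid i%:Z)).
have bound : \forall n \near \oo, (P (E n) <= (B n)%:E)%E.
  near=> n; apply: (near hn n) => //.
    apply: ltW; near: n; apply: (cvgr_lt (0 + 0)); first exact: lim3.
    by rewrite addr0.
  near: n; exact: (cvgr_lt 0 lim4).
apply: filterS (borel_cantelli mE cvB bound) => w; apply: filterS => n /= /negP.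
by rewrite -ltNge => /ltW.
Unshelve. all: by end_near. Qed.

End noise.

(** * Bias and noise combined *)

Theorem theorem1
  (R : realType)
  (F : Type) (dist : F -> F -> R)
  (V : completeNormedModType R) (ip : V -> V -> R)
  (d : measure_display) (Omega : measurableType d) (P : probability Omega R)
  (X : nat -> F) (x : F) (r : F -> V) (eps : nat -> Omega -> V)
  (W : nat -> nat -> R)
  (B M0 alpha : R) (k : nat -> nat) (b c2 : nat -> R)
  (psi phi : R -> R) (C0 rr M : R) (gamma : nat -> R)
  (a L xs : nat -> R) (m : nat -> nat) :
  (* F is a semi-metric space, V a separable Hilbert space *)
  semi_metric dist ->
  is_inner_product ip -> separable_space V ->
  (* (conditionally on the X_i) Y_i = r(X_i) + eps_i with E||Y_1|| < oo and
     r(x) = E(Y | X = x), i.e. E eps_i = 0 (Pettis sense) *)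
  P.-integrable setT (fun w => (`| r (X 0%N) + eps 0%N w |)%:E) ->
  (forall (i : nat) (e : V),
     P.-integrable setT (fun w => (ip (eps i w) e)%:E) /\
     (\int[P]_w (ip (eps i w) e)%:E = 0)%E) ->
  (* (W_n1, ..., W_nn) is a probability vector *)
  (forall n i, (i < n)%N -> 0 <= W n i) ->
  (forall n, (0 < n)%N -> \sum_(i < n) W n i = 1) ->
  (* (A1) *)
  0 < B -> 0 < M0 -> 0 < alpha ->
  (forall z, `|r z| <= B) ->
  (forall z z', `|r z - r z'| <= M0 * dist z z' `^ alpha) ->
  (* (A2) *)
  (forall n i j, (i <= j)%N -> (j < n)%N ->
     nn_weight dist X x W n j <= nn_weight dist X x W n i) ->
  ((fun n => (k n)%:R / n%:R : R) @ \oo --> 0) ->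
  ((fun n => (k n)%:R / ln (n%:R : R)) @ \oo --> +oo) ->
  (exists C : R, \forall n \near \oo,
     `|\sum_(k n <= i < n) nn_weight dist X x W n i| <= C * `|b n|) ->
  (exists C : R, \forall n \near \oo,
     Num.sqrt (\sum_(i < n) nn_weight dist X x W n i ^+ 2) <= C * `|c2 n|) ->
  (b @ \oo --> 0) -> (c2 @ \oo --> 0) ->
  ((fun n => knn_radius dist X x (k n) n) @ \oo --> 0) ->
  (* (A3) *)
  psi 0 = 0 ->
  (forall s t, 0 <= s -> s <= t -> psi s <= psi t) ->
  (forall s t l, 0 <= s -> 0 <= t -> 0 <= l -> l <= 1 ->
     psi (l * s + (1 - l) * t) <= l * psi s + (1 - l) * psi t) ->
  0 < C0 -> 2 <= rr ->
  phi 0 = 0 -> phi 1 = 1 ->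
  (forall s t, 0 <= s -> s <= t -> phi s <= phi t) ->
  (forall s t l, 0 <= s -> 0 <= t -> 0 <= l -> l <= 1 ->
     l * phi s + (1 - l) * phi t <= phi (l * s + (1 - l) * t)) ->
  (forall t, 0 <= t -> t `^ rr <= phi (psi (C0 * t))) ->
  (forall i, orlicz_norm P psi (fun w => `|eps i w|) = M%:E) ->
  (forall j, 0 <= gamma j) ->
  psi_m_approx ip P psi eps gamma ->
  (* the sequences a_n, L_n, x_n, m_n *)
  (a @ \oo --> 0) -> (L @ \oo --> 0) -> (xs @ \oo --> 0) ->
  (forall n, 0 < a n) -> (forall n, 0 < L n) -> (forall n, 0 < xs n) ->
  (forall n, (0 < n)%N -> (1 <= m n)%N /\ (m n <= n)%N) ->
  (exists C : R, 0 < C /\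
     cvg (series (fun n => expR (- (C * a n ^+ 2) /
            (a n * L n + (m n)%:R ^+ 2 * c2 n ^+ 2 + xs n))) @ \oo)) ->
  cvg (series (fun n => 1 / psi (Num.sqrt (xs n / 2) / (gamma 1%N * c2 n))) @ \oo) ->
  cvg (series (fun n => ((m n)%:R / a n) /
        (psi (L n / (2 * M * (m n)%:R * nn_weight dist X x W n 0%N))) `^ (1 - rr^-1))
        @ \oo) ->
  cvg (series (fun n => 1 / psi (a n /
        (2 * n%:R * nn_weight dist X x W n 0%N * gamma (m n)))) @ \oo) ->
  (* conclusion: ||rhat(x) - r(x)|| = O(b_n + H^alpha + a_n + (gamma_1 v_n1)^(1/2)) a.s. *)
  {ae P, forall w, exists C : R, \forall n \near \oo,
     `| \sum_(i < n) W n i *: (r (X i) + eps i w) - r x |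
       <= C * (`|b n| + knn_radius dist X x (k n) n `^ alpha + a n
               + Num.sqrt (gamma 1%N * nn_weight dist X x W n 0%N))}.
Proof.
move=> dP ipP sV _ centered W0 W1 B0 M00 al0 rB rH Wmono kn _ [Cb hb] hc2 _ _ _.
move=> psi0 psi_mono psi_convex C00 rr2 phi0 phi1 phi_mono phi_concave growth normM gamma0.
move=> approx _ _ _ a0 L0 xs0 mP cv1 _ cv3 cv4.
have [K K0 hK] := noise_ae ipP sV centered W0 W1 Wmono hc2 psi0 psi_mono psi_convex C00 rr2
  phi0 phi1 phi_mono phi_concave growth normM gamma0 approx a0 L0 xs0 mP cv1 cv3 cv4.
apply: filterS hK => w hw.
(* This constant is the same for all [w]; only the index from which the bound holds is random. *)
exists (M0 + 2 * B * `|Cb| + K); near=> n.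
have n0 : (0 < n)%N by near: n; exact: nbhs_infty_gt.
have nR : (0 : R) < n%:R by rewrite ltr0n.
(* Eventually [k n / n < 1]; the radius bounds distances only when [k n] neighbours exist. *)
have kn1 : (k n <= n)%N.
  rewrite -(ler_nat R) -[leRHS]mul1r -ler_pdivrMr//; apply: ltW.
  by near: n; exact: (cvgr_lt 0 kn).
have hnoise : `|\sum_(i < n) W n i *: eps i w| <= K * a n by near: n.
have htail : `|\sum_(k n <= i < n) nn_weight dist X x W n i| <= Cb * `|b n| by near: n.
have hbias := knn_bias X x dP (W0 n) (W1 n n0) (ltW M00) (ltW al0) rB rH kn1.
rewrite (_ : \sum_(i < n) _ - r x =
    (\sum_(i < n) W n i *: r (X i) - r x) + \sum_(i < n) W n i *: eps i w); last first.
  rewrite addrAC -big_split/=; congr (_ - _).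
  by apply: eq_bigr => i _; rewrite scalerDr.
apply: (le_trans (ler_normD _ _)).
set H := knn_radius dist X x (k n) n `^ alpha in hbias *.
set v := Num.sqrt _.
have H0 : 0 <= H by exact: powR_ge0.
have v0 : 0 <= v by exact: sqrtr_ge0.
have b0 : 0 <= `|b n| by exact: normr_ge0.
have an0 := ltW (a0 n).
have htail' : 2 * B * \sum_(k n <= i < n) nn_weight dist X x W n i <= 2 * B * `|Cb| * `|b n|.
  rewrite -(mulrA (2 * B)); apply: ler_wpM2l; first by rewrite mulr_ge0// ltW.
  apply: (le_trans (ler_norm _)); apply: (le_trans htail).
  by apply: ler_wpM2r => //; exact: ler_norm.
apply: (le_trans (lerD (le_trans hbias (lerD (lexx _) htail')) hnoise)).
have c0 : 0 <= 2 * B * `|Cb| by exact: mulr_ge0 (mulr_ge0 (ler0n _ 2) (ltW B0)) (normr_ge0 Cb).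
(* Expanding the product leaves the bound obtained plus nonnegative cross terms. *)
rewrite (_ : (M0 + 2 * B * `|Cb| + K) * (`|b n| + H + a n + v) =
  M0 * H + 2 * B * `|Cb| * `|b n| + K * a n +
  (M0 * (`|b n| + a n + v) + 2 * B * `|Cb| * (H + a n + v) + K * (`|b n| + H + v))); last by ring.
rewrite lerDl; apply: addr_ge0; first apply: addr_ge0.
- by apply: mulr_ge0; [exact: ltW|do 2?apply: addr_ge0].
- by apply: mulr_ge0; [|do 2?apply: addr_ge0].
- by apply: mulr_ge0; [|do 2?apply: addr_ge0].
Unshelve. all: by end_near. Qed.
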